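(* Let $\phi \in L^1(\mathbb{R}_+)$ with $\int_0^\infty \phi(x)\,dx = 1$. Then the summability method $S_{\phi}^*$ is equivalent to the summability method $K$ if and only if the closed ideal generated by $\phi^*$ in $L^1(\mathbb{R})$ is the whole space $L^1(\mathbb{R})$.
   Context: $\mathbb{R}_+ = [0,\infty)$ with Lebesgue measure; functions are complex-valued. For $f \in L^{\infty}(\mathbb{R}_+)$: $K(f) = \alpha$ means that $f(\cdot + s)$ converges, as $s\to\infty$, to the constant $\alpha$ in the weak* topology of $L^{\infty}(\mathbb{R}_+) = L^1(\mathbb{R}_+)^*$; $\mathcal{D}(K)$ is the set of $f$ for which such a constant weak* limit exists. $S^*_{\phi}(f) = \lim_{x\to\infty}\int_x^{\infty} f(t)\phi(t-x)\,dt$, with domain the set of $f \in L^\infty(\mathbb{R}_+)$ for which the limit exists. $S$ is stronger than $S'$ if $\mathcal{D}(S') \subseteq \mathcal{D}(S)$ and $S = S'$ on $\mathcal{D}(S')$; equivalent if each is stronger than the other. $\phi^* \in L^1(\mathbb{R})$ is defined by $\phi^*(x) = 0$ for $x \ge 0$ and $\phi^*(x) = \phi(-x)$ for $x < 0$. $L^1(\mathbb{R})$ is the Banach algebra under convolution $(f*g)(x) = \int_{-\infty}^\infty f(x-t)g(t)\,dt$. *)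

(* Defs.v *)
From HB Require Import structures.
From mathcomp Require Import all_boot all_order all_algebra.
From mathcomp Require Import all_classical all_reals all_analysis.
From mathcomp Require Import complex.
Import Order.TTheory GRing.Theory Num.Theory.
Import numFieldNormedType.Exports.

Set Implicit Arguments.
Unset Strict Implicit.
Unset Printing Implicit Defensive.

Local Open Scope ring_scope.
Local Open Scope classical_set_scope.

Section Defs.
Context {R : realType}.
Local Notation C := R[i].
Local Notation mu := (@lebesgue_measure R).

Definition cRe (z : C) : R := complex.Re z.
Definition cIm (z : C) : R := complex.Im z.
Definition cabs (z : C) : R := Normc.normc z.

Definition Rplus : set R := `[0, +oo[%classic.

Definition cmeasurable (D : set R) (f : R -> C) : Prop :=
  measurable_fun D (cRe \o f) /\ measurable_fun D (cIm \o f).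

Definition cintegrable (D : set R) (f : R -> C) : Prop :=
  mu.-integrable D (EFin \o (cRe \o f)) /\ mu.-integrable D (EFin \o (cIm \o f)).

Definition cint (D : set R) (f : R -> C) : C :=
  Complex (Rintegral mu D (cRe \o f)) (Rintegral mu D (cIm \o f)).

Definition ccvg_pinfty (u : R -> C) (l : C) : Prop :=
  cRe (u x) @[x --> +oo] --> cRe l /\ cIm (u x) @[x --> +oo] --> cIm l.

Definition Linfty_Rplus (f : R -> C) : Prop :=
  cmeasurable Rplus f /\
  exists M : R, {ae mu, forall x, Rplus x -> cabs (f x) <= M}.

(* A summability method on L^oo(R_+): the relation "f is in the domain
   and the method assigns the value a to f". *)
Definition method := (R -> C) -> C -> Prop.

(* K(f) = a : f(. + s) --> a (constant) weak* in L^oo(R_+) = L^1(R_+)^* *)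
Definition Ksum : method := fun f a =>
  Linfty_Rplus f /\
  forall g : R -> C, cintegrable Rplus g ->
    ccvg_pinfty (fun s => cint Rplus (fun t => f (t + s) * g t))
                (a * cint Rplus g).

Definition Sstar (phi : R -> C) : method := fun f a =>
  Linfty_Rplus f /\
  ccvg_pinfty (fun x => cint `[x, +oo[%classic (fun t => f t * phi (t - x))) a.

Definition domain (S : method) : set (R -> C) := [set f | exists a, S f a].

Definition stronger (S S' : method) : Prop :=
  domain S' `<=` domain S /\
  (forall f a b, S' f a -> S f b -> b = a).

Definition equivalent (S S' : method) : Prop := stronger S S' /\ stronger S' S.

Definition phistar (phi : R -> C) : R -> C :=
  fun x => if x < 0 then phi (- x) else 0.

Definition L1 : set (R -> C) := [set f | cintegrable setT f].

Definition conv (f g : R -> C) : R -> C :=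
  fun x => cint setT (fun t => f (x - t) * g t).

(* closed ideals of L^1(R) (sets of functions; closedness w.r.t. the L^1
   seminorm makes them saturated under a.e. equality, so this is the same as
   closed ideals of the quotient space L^1(R)) *)
Definition closed_ideal (I : set (R -> C)) : Prop :=
  [/\ I `<=` L1,
      I (fun=> 0),
      (forall f g, I f -> I g -> I (fun x => f x + g x)),
      (forall (c : C) f, I f -> I (fun x => c * f x)) &
      ((forall f h, I f -> L1 h ->
          exists2 k, I k & {ae mu, forall x, k x = conv h f x}) /\
       (forall f, L1 f ->
          (forall e : R, 0 < e ->
             exists2 g, I g & (\int[mu]_x (cabs (f x - g x))%:E < e%:E)%E) ->
          I f))].

Definition closed_ideal_gen (h : R -> C) : set (R -> C) :=
  \bigcap_(I in [set I | closed_ideal I /\ I h]) I.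

End Defs.

(* Main.v *)
Require Import Defs.
From HB Require Import structures.
From mathcomp Require Import all_boot all_order all_algebra.
From mathcomp Require Import all_classical all_reals all_analysis.
From mathcomp Require Import measurable_realfun complex.
From mathcomp Require Import ring lra.
Import Order.TTheory GRing.Theory Num.Theory.
Import numFieldNormedType.Exports.
Set Implicit Arguments.
Unset Strict Implicit.
Unset Printing Implicit Defensive.
Local Open Scope ring_scope.
Local Open Scope classical_set_scope.

(* If [f] is bounded, the [g] in L^1(R) with [g * f(x) -> a \int g] as [x -> +oo]
   form a closed ideal (Wiener).  When [phi^*] generates L^1(R), this ideal
   contains every [g^*] as soon as it contains [phi^*], and [S^*_phi(f) = a]
   gives [K(f) = a].

   Conversely, if [phi^*] lies in a proper closed ideal [I], Hahn-Banach gives a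
   bounded nonzero functional [L] on L^1(R) that vanishes on [I].  For some [d]
   the function [F(x) = L(1_(x, x + d])] is nonzero; it is bounded and Lipschitz,
   and [H(x) = F(- x)] satisfies [\int_0^oo H(x + u) phi(u) du = 0] for all real [x].
   Copies of [H] centred at points tending to infinity and modulated by a slowly
   varying factor form a bounded function [J] with [S^*_phi(J) = 0].  Along the
   centres the translates of [J] reproduce a multiple of [H], so [K(J) = 0] fails. *)

(** * Integrable functions on the line *)

Section real_L1.
Context {R : realType}.
Local Notation mu := (@lebesgue_measure R).
Implicit Types f g h : R -> R.

(** [H] alone need not separate the methods: nothing in its construction keeps it from tending to 0
    at infinity, in which case K(H) = 0. Copies bring its values near one point back at arbitrarily
    late times. Plain copies would spoil the limit of [Sstar] where they meet. A factor that
    vanishes at the junctions and varies by O(u / sqrt x) on [x, x + u] makes the integral at x, up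
    to o(1), a bounded multiple of the vanishing integral of [H].

    [L] is never represented by a bounded density. [F] replaces that density smoothed over an
    interval of length d: it has a value at every point and is Lipschitz. The price is that [L] has
    to be interchanged by hand with an integral of translates.

    A complex function is handled as a pair of real ones, and [L] is only real-linear: a functional
    of the real part plus one of the imaginary part. As an ideal is stable under multiplication by
    i, the vanishing of [L] on it gives both the real and the imaginary part of the orthogonality
    relation for [H]. *)

Definition rL1 f := mu.-integrable setT (EFin \o f).

Definition L1norm f := \int[mu]_x `|f x|.

Lemma rL1_measurable f : rL1 f -> measurable_fun setT f.
Proof. by move/measurable_int/measurable_EFinP. Qed.

Lemma rL1_le f g : measurable_fun setT f -> (forall x, `|f x| <= `|g x|) ->
  rL1 g -> rL1 f.
Proof.
move=> mf fg; apply: le_integrable => //; first exact/measurable_EFinP.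
by move=> x _ /=; rewrite lee_fin.
Qed.

Lemma rL1_0 : rL1 (fun=> 0).
Proof. exact: integrable0. Qed.

Lemma rL1D f g : rL1 f -> rL1 g -> rL1 (fun x => f x + g x).
Proof. by move=> lf lg; exact: (integrableD measurableT lf lg). Qed.

Lemma rL1Z c f : rL1 f -> rL1 (fun x => c * f x).
Proof. by move=> lf; exact: (integrableZl measurableT c lf). Qed.

Lemma rL1N f : rL1 f -> rL1 (fun x => - f x).
Proof. by move=> lf; under eq_fun do rewrite -mulN1r; exact: rL1Z. Qed.

Lemma rL1B f g : rL1 f -> rL1 g -> rL1 (fun x => f x - g x).
Proof. by move=> lf lg; apply: rL1D => //; exact: rL1N. Qed.

Lemma rL1_norm f : rL1 f -> rL1 (fun x => `|f x|).
Proof. exact: integrable_norm. Qed.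

Lemma rL1Ml h f M : measurable_fun setT h -> (forall x, `|h x| <= M) ->
  rL1 f -> rL1 (fun x => h x * f x).
Proof.
move=> mh hM lf; apply: (@rL1_le _ (fun x => M * f x)); last exact: rL1Z.
  by apply: measurable_funM => //; exact: rL1_measurable.
move=> x; rewrite !normrM ler_wpM2r//.
by rewrite (le_trans (hM x))// ler_norm.
Qed.

Lemma rL1_indic_itv (a b : R) (s t : bool) :
  rL1 (\1_[set` Interval (BSide s a) (BSide t b)]).
Proof. exact: integrable_indic_itv. Qed.

Lemma L1norm_ge0 f : 0 <= L1norm f.
Proof. by apply: Rintegral_ge0 => x _. Qed.

Lemma L1norm_le f g : rL1 f -> rL1 g -> (forall x, `|f x| <= g x) ->
  L1norm f <= \int[mu]_x g x.
Proof.
by move=> lf lg fg; apply: le_Rintegral => //; exact: rL1_norm.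
Qed.

Lemma L1normD f g : rL1 f -> rL1 g ->
  L1norm (fun x => f x + g x) <= L1norm f + L1norm g.
Proof.
move=> lf lg; rewrite /L1norm -RintegralD//; [|exact: rL1_norm..].
apply: le_Rintegral => //; first exact/rL1_norm/rL1D.
  by apply: rL1D; exact: rL1_norm.
by move=> x _; exact: ler_normD.
Qed.

Lemma L1normZ c f : rL1 f -> L1norm (fun x => c * f x) = `|c| * L1norm f.
Proof.
move=> lf; rewrite /L1norm -RintegralZl//; last exact: rL1_norm.
by under eq_Rintegral do rewrite normrM.
Qed.

Lemma norm_Rintegral_le f : rL1 f -> `|\int[mu]_x f x| <= L1norm f.
Proof. exact: le_normr_Rintegral. Qed.

Lemma EFin_L1norm f : rL1 f -> (L1norm f)%:E = (\int[mu]_x `|(f x)%:E|)%E.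
Proof.
move=> lf; rewrite /L1norm /Rintegral fineK//.
exact: (integrable_fin_num measurableT (rL1_norm lf)).
Qed.

Lemma ae_imply (P Q : R -> Prop) : {ae mu, forall x, P x} ->
  (forall x, P x -> Q x) -> {ae mu, forall x, Q x}.
Proof.
move=> h PQ.
by move: h; apply: (@filterS _ _ (ae_filter_ringOfSetsType mu)) => x; exact: PQ.
Qed.

Lemma ae_conj (P Q : R -> Prop) : {ae mu, forall x, P x} ->
  {ae mu, forall x, Q x} -> {ae mu, forall x, P x /\ Q x}.
Proof.
by move=> hP hQ; apply: (@filterS2 _ _ (ae_filter_ringOfSetsType mu) _ _ _ _ hP hQ).
Qed.

Lemma ae_eq_Rintegral (D : set R) f g : measurable D ->
  measurable_fun D f -> measurable_fun D g ->
  {ae mu, forall x, D x -> f x = g x} ->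
  \int[mu]_(x in D) f x = \int[mu]_(x in D) g x.
Proof.
move=> mD mf mg fg; rewrite /Rintegral; congr fine.
have fg' : {ae mu, forall x, D x -> (EFin \o f) x = (EFin \o g) x}.
  by apply: (ae_imply fg) => x h Dx /=; rewrite h.
apply: (@ae_eq_integral _ _ _ mu) => //; exact/measurable_EFinP.
Qed.

Lemma L1norm_ae0 f : measurable_fun setT f -> {ae mu, forall x, f x = 0} ->
  L1norm f = 0.
Proof.
(* 0 is written as the integral of the constant 0, that is, 0 times [fine (mu setT)]. The measure is
   infinite and its [fine] a default value, which the factor 0 absorbs. *)
move=> mf f0; rewrite /L1norm -[RHS](mul0r (fine (mu setT))) -Rintegral_cst//.
apply: ae_eq_Rintegral => //; first exact: measurableT_comp.
by apply: (ae_imply f0) => x -> _; rewrite normr0.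
Qed.

(** * Measure-preserving substitutions *)

Section change_of_variables.
Local Notation T := (measurableTypeR R).
Variable (phi : T -> T).
Hypothesis mphi : measurable_fun setT phi.
Hypothesis phi_mu : forall A : set R, ocitv A -> mu A = mu (phi @^-1` A).

Let mphi_mixin := isMeasurableFun.Build _ _ _ _ _ mphi.
Let phi_pack : {mfun _ >-> _} := HB.pack phi mphi_mixin.

(** The push-forward of Lebesgue measure by [phi] agrees with it on half-open intervals, so
    uniqueness identifies the two measures. *)
Let ge0_integral_comp (f : T -> \bar R) : measurable_fun setT f ->
  (forall x, 0 <= f x)%E -> (\int[mu]_x f (phi x) = \int[mu]_x f x)%E.
Proof.
move=> mf f0; transitivity (\int[pushforward mu phi]_x f x)%E.
  by rewrite (@ge0_integral_pushforward _ _ _ _ _ _ mphi mu).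
apply/esym/eq_measure_integral => A mA _.
exact: (@lebesgue_measure_unique _ (pushforward mu phi_pack)).
Qed.

Lemma integral_comp (f : T -> \bar R) : measurable_fun setT f ->
  (\int[mu]_x f (phi x) = \int[mu]_x f x)%E.
Proof.
move=> mf; rewrite [LHS]integralE [RHS]integralE.
congr (_ - _)%E.
  have -> : (fun x => f (phi x))^\+%E = f^\+%E \o phi by exact: funepos_comp.
  exact: (ge0_integral_comp (measurable_funepos mf) (funepos_ge0 f)).
have -> : (fun x => f (phi x))^\-%E = f^\-%E \o phi by exact: funeneg_comp.
exact: (ge0_integral_comp (measurable_funeneg mf) (funeneg_ge0 f)).
Qed.

Lemma Rintegral_comp f : measurable_fun setT f ->
  \int[mu]_x f (phi x) = \int[mu]_x f x.
Proof.
move=> mf; rewrite /Rintegral; congr fine.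
by rewrite -[RHS]integral_comp//; exact/measurable_EFinP.
Qed.

Lemma rL1_comp f : rL1 f -> rL1 (fun x => f (phi x)).
Proof.
move=> /integrableP[mf foo]; apply/integrableP; split.
  by apply: (measurableT_comp mf).
apply: le_lt_trans foo; rewrite le_eqVlt; apply/orP; left; apply/eqP.
rewrite -[RHS]integral_comp//; exact: measurableT_comp.
Qed.

End change_of_variables.

Lemma ocitv_shift s (A : set R) : ocitv A ->
  mu A = mu ((fun x => x + s) @^-1` A).
Proof.
move=> -[[a b] _ /= <-].
rewrite (_ : _ @^-1` _ = `]a - s, b - s]%classic); last first.
  by apply/seteqP; split => x /=; rewrite !in_itv/= ltrBlDr lerBrDr.
rewrite !lebesgue_measure_itv/= !lte_fin ltrD2r; case: ifP => // _.
by rewrite -!EFinB; congr (_%:E); lra.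
Qed.

Lemma ocitv_opp (A : set R) : ocitv A -> mu A = mu (-%R @^-1` A).
Proof.
move=> -[[a b] _ /= <-].
rewrite (_ : _ @^-1` _ = `[- b, - a[%classic); last first.
  by apply/seteqP; split => x /=; rewrite !in_itv/= ltrNr lerNl andbC.
rewrite !lebesgue_measure_itv/= !lte_fin ltrN2; case: ifP => // _.
by rewrite -!EFinB; congr (_%:E); lra.
Qed.

Lemma measurable_shift (s : R) : measurable_fun setT (fun x : R => x + s).
Proof. exact: measurable_funD. Qed.

Lemma Rintegral_shift s f : measurable_fun setT f ->
  \int[mu]_x f (x + s) = \int[mu]_x f x.
Proof.
by apply: Rintegral_comp; [exact: measurable_shift|exact: ocitv_shift].
Qed.

Lemma Rintegral_opp f : measurable_fun setT f ->
  \int[mu]_x f (- x) = \int[mu]_x f x.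
Proof. by apply: Rintegral_comp => //; exact: ocitv_opp. Qed.

Lemma rL1_shift s f : rL1 f -> rL1 (fun x => f (x + s)).
Proof. by apply: rL1_comp; [exact: measurable_shift|exact: ocitv_shift]. Qed.

Lemma rL1_opp f : rL1 f -> rL1 (fun x => f (- x)).
Proof. by apply: rL1_comp => //; exact: ocitv_opp. Qed.

Lemma measurable_reflect (s : R) f : measurable_fun setT f ->
  measurable_fun setT (fun x : R => f (s - x)).
Proof.
by move=> mf; apply: measurableT_comp => //; exact: measurable_funB.
Qed.

Lemma Rintegral_reflect s f : measurable_fun setT f ->
  \int[mu]_x f (s - x) = \int[mu]_x f x.
Proof.
move=> mf; rewrite -(Rintegral_opp mf) -(@Rintegral_shift (- s) (f \o -%R)).
  by apply: eq_Rintegral => x _ /=; rewrite opprD opprK addrC.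
exact: measurableT_comp.
Qed.

Lemma rL1_reflect s f : rL1 f -> rL1 (fun x => f (s - x)).
Proof.
move=> /rL1_opp /(@rL1_shift (- s)).
by under eq_fun do rewrite opprD opprK addrC.
Qed.

Lemma L1norm_shift s f : measurable_fun setT f ->
  L1norm (fun x => f (x + s)) = L1norm f.
Proof.
move=> mf; apply: (@Rintegral_shift s (fun x => `|f x|)).
exact: measurableT_comp.
Qed.

Lemma L1norm_reflect s f : measurable_fun setT f ->
  L1norm (fun x => f (s - x)) = L1norm f.
Proof.
move=> mf; apply: (@Rintegral_reflect s (fun x => `|f x|)).
exact: measurableT_comp.
Qed.

End real_L1.

(** * Fubini's theorem and convolution *)

Section convolution.
Context {R : realType}.
Local Notation mu := (@lebesgue_measure R).
Local Notation T := (measurableTypeR R).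
Implicit Types f g h : R -> R.

Lemma Rintegral_dominated_cvg (f_ : (R -> R)^nat) f g :
  (forall n, measurable_fun setT (f_ n)) -> rL1 g ->
  (forall n x, `|f_ n x| <= g x) -> (forall x, f_ n x @[n --> \oo] --> f x) ->
  \int[mu]_x f_ n x @[n --> \oo] --> \int[mu]_x f x.
Proof.
move=> mf_ lg fg f_f.
have mf : measurable_fun setT f.
  by apply: (measurable_fun_cvg mf_) => x _; exact: f_f.
have mEf_ n : measurable_fun setT (EFin \o f_ n) by exact/measurable_EFinP.
have mEf : measurable_fun setT (EFin \o f) by exact/measurable_EFinP.
have cf : {ae mu, forall x, setT x ->
    (EFin \o f_ n) x @[n --> \oo] --> (EFin \o f) x}.
  apply: aeW => x _; apply: cvg_EFin; last exact: f_f.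
  by apply: nearW.
have df : {ae mu, forall x n, setT x -> (`|(EFin \o f_ n) x| <= (EFin \o g) x)%E}.
  by apply: aeW => x n _ /=; rewrite lee_fin.
have [lf _ h] := @dominated_convergence _ T R mu setT measurableT
  (fun n => EFin \o f_ n) (EFin \o f) (EFin \o g) mEf_ mEf cf lg df.
apply: fine_cvg.
by rewrite fineK//; exact: integrable_fin_num.
Qed.

(** The integral is by definition [fine] of a difference of integrals of positive and negative
    parts. Each of these is measurable by Tonelli, and so is [fine]. *)
Lemma measurable_Rintegral2 (k : R -> R -> R) :
  measurable_fun setT (fun z : T * T => k z.1 z.2) ->
  measurable_fun setT (fun x => \int[mu]_y k x y).
Proof.
move=> mk; pose K (z : T * T) := (k z.1 z.2)%:E.
have mK : measurable_fun setT K by exact/measurable_EFinP.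
have -> : (fun x => \int[mu]_y k x y) =
    fine \o ((fun x => \int[mu]_y K^\+ (x, y)) \-
             (fun x => \int[mu]_y K^\- (x, y)))%E.
  apply/funext => x; rewrite /Rintegral/= [in LHS]integralE; congr fine.
  congr (_ - _)%E; apply: eq_integral => y _.
    exact: (congr1 (@^~ y) (funepos_comp K (fun y => (x, y)))).
  exact: (congr1 (@^~ y) (funeneg_comp K (fun y => (x, y)))).
apply: (measurableT_comp (fine_measurable _)) => //; apply: emeasurable_funB.
  apply: (@measurable_fun_fubini_tonelli_F _ _ T T _ mu (K^\+)%E) => //.
  exact: measurable_funepos.
apply: (@measurable_fun_fubini_tonelli_F _ _ T T _ mu (K^\-)%E) => //.
exact: measurable_funeneg.
Qed.

(** * Fubini's theorem for kernels with controlled columns *)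

Section fubini.
Variables (k : R -> R -> R) (b : R -> R).
Hypothesis mk : measurable_fun setT (fun z : T * T => k z.1 z.2).
Hypothesis lk : forall y, rL1 (k^~ y).
Hypothesis kb : forall y, L1norm (k^~ y) <= b y.
Hypothesis lb : rL1 b.

Let K (z : T * T) := (k z.1 z.2)%:E.

Let mK : measurable_fun setT K. Proof. exact/measurable_EFinP. Qed.

Let mabsK : measurable_fun setT (abse \o K).
Proof. exact: measurableT_comp. Qed.

Let absK_ge0 z : (0 <= (abse \o K) z)%E.
Proof. exact: abse_ge0. Qed.

Let le_int : (\int[mu]_y \int[mu]_x `|K (x, y)| <= (\int[mu]_y b y)%:E)%E.
Proof.
rewrite /Rintegral fineK; last exact: (integrable_fin_num measurableT lb).
apply: ge0_le_integral => //.
- by move=> y _; exact: integral_ge0.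
- exact: (@measurable_fun_fubini_tonelli_G _ _ T T _ mu (abse \o K) mabsK absK_ge0).
- exact: measurable_int lb.
- by move=> y _; have := kb y; rewrite -lee_fin EFin_L1norm.
Qed.

Let iK : (mu \x mu)%E.-integrable setT K.
Proof.
apply/integrable21ltyP => //; apply: le_lt_trans le_int _; exact: ltry.
Qed.

Lemma ae_rL1_fubini : {ae mu, forall x, rL1 (k x)}.
Proof. exact: ae_imply (ae_integrable1 iK) _. Qed.

Let F x := (\int[mu]_y K (x, y))%E.
Let G y := (\int[mu]_x K (x, y))%E.

Let iF : mu.-integrable setT F. Proof. exact: integrable_fubini_F iK. Qed.

(** Rows are integrable only almost everywhere. [fine] changes the inner integral only where it is
    infinite, which happens on a null set. *)
Let integrable_fine (H : R -> \bar R) : mu.-integrable setT H ->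
  rL1 (fine \o H) /\ (\int[mu]_x (fine (H x))%:E = \int[mu]_x H x)%E.
Proof.
move=> iH; have mH := measurable_int mu iH.
have mfH : measurable_fun setT (EFin \o (fine \o H)).
  by apply/measurable_EFinP; exact: (measurableT_comp (fine_measurable _)).
split.
  apply: (@le_integrable _ _ _ mu setT measurableT _ H) => // x _ /=.
  by case: (H x) => //=; rewrite ?normr0 ?leey.
apply: (@ae_eq_integral _ _ _ mu) => //.
apply: ae_imply (integrable_ae measurableT iH) _ => x /(_ I) h _ /=.
by rewrite fineK.
Qed.

Lemma rL1_fubini : rL1 (fun x => \int[mu]_y k x y).
Proof. exact: (integrable_fine iF).1. Qed.

Lemma Rintegral_fubini :
  \int[mu]_x \int[mu]_y k x y = \int[mu]_y \int[mu]_x k x y.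
Proof.
rewrite /Rintegral; congr fine.
rewrite (integrable_fine iF).2.
have -> : (\int[mu]_y (fine (\int[mu]_x (k x y)%:E))%:E = \int[mu]_y G y)%E.
  apply: eq_integral => y _.
  by rewrite fineK//; exact: (integrable_fin_num measurableT (lk y)).
by rewrite /F /G (integral12_prod_meas1 iK) (integral21_prod_meas1 iK).
Qed.

(** Minkowski's integral inequality, by Tonelli for [|k|]. Where the inner integral is infinite, its
    [fine] is 0 and the pointwise bound still holds. *)
Lemma L1norm_fubini : L1norm (fun x => \int[mu]_y k x y) <= \int[mu]_y b y.
Proof.
rewrite -lee_fin (EFin_L1norm rL1_fubini); apply: le_trans le_int.
have := @fubini_tonelli _ _ T T _ mu mu (abse \o K) mabsK absK_ge0.
move=> /= <-.
apply: ge0_le_integral => //.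
- exact: (measurable_int mu (integrable_norm rL1_fubini)).
- exact: (@measurable_fun_fubini_tonelli_F _ _ T T _ mu (abse \o K) mabsK absK_ge0).
move=> x _; apply: (@le_trans _ _ `|F x|%E).
  by rewrite /Rintegral /F; case: (\int[mu]_y _)%E => //=; rewrite ?normr0 ?leey.
by apply: le_abse_integral => //; exact: measurableT_comp.
Qed.

End fubini.

Definition rconv h f : R -> R := fun x => \int[mu]_t (h (x - t) * f t).

Lemma measurable_kernel h f : measurable_fun setT h -> measurable_fun setT f ->
  measurable_fun setT (fun z : T * T => h (z.1 - z.2) * f z.2).
Proof.
move=> mh mf; apply: measurable_funM; last exact: measurableT_comp.
by apply: (measurableT_comp mh); exact: measurable_funB.
Qed.

Lemma measurable_rconv h f : measurable_fun setT h -> measurable_fun setT f ->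
  measurable_fun setT (rconv h f).
Proof.
move=> mh mf.
exact: (@measurable_Rintegral2 (fun x t => h (x - t) * f t)
  (measurable_kernel mh mf)).
Qed.

Section young.
Variables (h f : R -> R).
Hypothesis lh : rL1 h.
Hypothesis lf : rL1 f.

Let k x t := h (x - t) * f t.

Let mk : measurable_fun setT (fun z : T * T => k z.1 z.2).
Proof. by apply: measurable_kernel; exact: rL1_measurable. Qed.

Let lk t : rL1 (k^~ t).
Proof.
rewrite /k; under eq_fun do rewrite mulrC.
exact/rL1Z/(rL1_shift (- t)).
Qed.

Let kb t : L1norm (k^~ t) <= L1norm h * `|f t|.
Proof.
rewrite /k (_ : (fun _ => _) = (fun x => f t * h (x - t))); last first.
  by apply/funext => x; rewrite mulrC.
rewrite L1normZ; last exact: rL1_shift.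
by rewrite (L1norm_shift (- t)) 1?mulrC//; exact: rL1_measurable.
Qed.

Let lb : rL1 (fun t => L1norm h * `|f t|).
Proof. exact/rL1Z/rL1_norm. Qed.

Lemma rL1_rconv : rL1 (rconv h f).
Proof. exact: rL1_fubini mk lk kb lb. Qed.

Lemma ae_rL1_rconv : {ae mu, forall x, rL1 (fun t => h (x - t) * f t)}.
Proof. exact: ae_rL1_fubini mk lk kb lb. Qed.

Lemma L1norm_rconv : L1norm (rconv h f) <= L1norm h * L1norm f.
Proof.
apply: le_trans (L1norm_fubini mk lk kb lb) _.
by rewrite RintegralZl//; exact: rL1_norm.
Qed.

Lemma Rintegral_rconv :
  \int[mu]_x rconv h f x = (\int[mu]_x h x) * \int[mu]_x f x.
Proof.
rewrite /rconv (Rintegral_fubini mk lk kb lb) -RintegralZl//.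
apply: eq_Rintegral => t _; rewrite /k RintegralZr//; last exact: rL1_shift.
by rewrite (Rintegral_shift (- t))//; exact: rL1_measurable.
Qed.

End young.

Section bounded_convolution.
Variables (w : R -> R) (M : R).
Hypothesis mw : measurable_fun setT w.
Hypothesis wM : forall x, `|w x| <= M.

Lemma rL1_rconv_bounded h x : rL1 h -> rL1 (fun t => h (x - t) * w t).
Proof.
move=> lh; under eq_fun do rewrite mulrC.
by apply: (rL1Ml mw wM); exact: rL1_reflect.
Qed.

Lemma norm_rconv_bounded h x : rL1 h -> `|rconv h w x| <= M * L1norm h.
Proof.
move=> lh; apply: le_trans (norm_Rintegral_le (rL1_rconv_bounded _ lh)) _.
rewrite -(L1norm_reflect x (rL1_measurable lh)) /L1norm -RintegralZl//; last first.
  exact/rL1_norm/rL1_reflect.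
apply: le_Rintegral => //.
- exact/rL1_norm/rL1_rconv_bounded.
- exact/rL1Z/rL1_norm/rL1_reflect.
by move=> t _; rewrite normrM mulrC ler_wpM2r.
Qed.

Lemma rconvA h g x : rL1 h -> rL1 g ->
  rconv (rconv h g) w x = rconv h (rconv g w) x.
Proof.
move=> lh lg; have mh := rL1_measurable lh; have mg := rL1_measurable lg.
pose k t s := h (x - s) * (g (s - t) * w t).
have mk : measurable_fun setT (fun z : T * T => k z.1 z.2).
  apply: measurable_funM.
    by apply: (measurableT_comp mh); apply: measurable_funB.
  apply: measurable_funM; last exact: measurableT_comp.
  by apply: (measurableT_comp mg); exact: measurable_funB.
have lk s : rL1 (k^~ s) by exact/rL1Z/rL1_rconv_bounded.
have kb s : L1norm (k^~ s) <= M * L1norm g * `|h (x - s)|.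
  rewrite L1normZ; last exact: rL1_rconv_bounded.
  rewrite mulrC ler_wpM2r//.
  rewrite -(L1norm_reflect s (rL1_measurable lg)) /L1norm -RintegralZl//; last first.
    exact/rL1_norm/rL1_reflect.
  apply: le_Rintegral => //.
  - exact/rL1_norm/rL1_rconv_bounded.
  - exact/rL1Z/rL1_norm/rL1_reflect.
  by move=> t _; rewrite normrM mulrC ler_wpM2r.
have lb : rL1 (fun s => M * L1norm g * `|h (x - s)|).
  exact/rL1Z/rL1_norm/rL1_reflect.
transitivity (\int[mu]_t \int[mu]_s k t s); last first.
  rewrite (Rintegral_fubini mk lk kb lb); apply: eq_Rintegral => s _.
  by rewrite /k RintegralZl//; exact: rL1_rconv_bounded.
apply: ae_eq_Rintegral => //.
- by apply: rL1_measurable; apply: rL1_rconv_bounded; exact: rL1_rconv.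
- by apply: rL1_measurable; exact: (rL1_fubini mk lk kb lb).
apply: ae_imply (ae_rL1_fubini mk lk kb lb) _ => t lkt _.
(* Fubini gives integrability in [s] of the product including the factor [w t]. Where [w t] is 0
   both sides vanish; elsewhere dividing by it makes the remaining product integrable, so that the
   factor can be pulled out. *)
have [wt0|wt0] := eqVneq (w t) 0.
  rewrite wt0 mulr0 /k -(mul0r (fine (mu setT))) -Rintegral_cst//.
  by apply: eq_Rintegral => s _; rewrite wt0 !mulr0.
have lhg : rL1 (fun s => h (x - s) * g (s - t)).
  have := rL1Z (w t)^-1 lkt; congr rL1; apply/funext => s.
  by rewrite /k; field.
rewrite /k; under [RHS]eq_Rintegral do rewrite mulrA.
rewrite RintegralZr//; congr (_ * _).
rewrite /rconv -(@Rintegral_shift _ (- t)); last first.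
  by apply: measurable_funM => //; exact: measurable_reflect.
by apply: eq_Rintegral => s _; congr (h _ * _); lra.
Qed.

(** A reflection moves the translation from [h] to [w]; then dominated convergence applies along
    sequences, with bound [M * |h|]. *)
Lemma rconv_cvg h l : rL1 h -> w x @[x --> +oo] --> l ->
  rconv h w x @[x --> +oo] --> (\int[mu]_x h x) * l.
Proof.
move=> lh wl; have mh := rL1_measurable lh; apply/cvg_pinftyP => u uoo.
have -> : (fun n => rconv h w (u n)) =
    (fun n => \int[mu]_t (h t * w (u n - t))).
  apply/funext => n; rewrite /rconv -(@Rintegral_reflect _ (u n)); last first.
    by apply: measurable_funM => //; exact: measurable_reflect.
  by apply: eq_Rintegral => t _; congr (h _ * _); lra.
rewrite mulrC -RintegralZl//.
apply: (@Rintegral_dominated_cvg _ _ (fun x => M * `|h x|)).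
- by move=> n; apply: measurable_funM => //; exact: measurable_reflect.
- exact/rL1Z/rL1_norm.
- by move=> n x; rewrite normrM mulrC ler_wpM2r.
move=> x; rewrite mulrC; apply: cvgM; first exact: cvg_cst.
apply: (cvg_comp _ _ _ wl).
under eq_fun do rewrite addrC; apply: (cvg_comp _ _ uoo).
exact: cvg_addrl.
Qed.

End bounded_convolution.
End convolution.

(** * Complex-valued functions on the half-line *)

Section complex_glue.
Context {R : realType}.
Local Notation mu := (@lebesgue_measure R).
Local Notation T := (measurableTypeR R).
Local Notation C := R[i].
Implicit Types (z w : C).

Lemma cReD z w : cRe (z + w) = cRe z + cRe w.
Proof. by case: z; case: w. Qed.

Lemma cImD z w : cIm (z + w) = cIm z + cIm w.
Proof. by case: z; case: w. Qed.

Lemma cReB z w : cRe (z - w) = cRe z - cRe w.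
Proof. by case: z; case: w. Qed.

Lemma cImB z w : cIm (z - w) = cIm z - cIm w.
Proof. by case: z; case: w. Qed.

Lemma cReM z w : cRe (z * w) = cRe z * cRe w - cIm z * cIm w.
Proof. by case: z; case: w. Qed.

Lemma cImM z w : cIm (z * w) = cRe z * cIm w + cIm z * cRe w.
Proof. by case: z => a b; case: w => c d. Qed.

Lemma complexP z w : cRe z = cRe w -> cIm z = cIm w -> z = w.
Proof. by case: z => a b; case: w => c d /= -> ->. Qed.

Lemma cabsE z : cabs z = Num.sqrt (cRe z ^+ 2 + cIm z ^+ 2).
Proof. by case: z. Qed.

Lemma cabs_ge0 z : 0 <= cabs z.
Proof. by rewrite cabsE sqrtr_ge0. Qed.

Lemma norm_cRe_le z : `|cRe z| <= cabs z.
Proof. by rewrite cabsE -sqrtr_sqr ler_wsqrtr// lerDl sqr_ge0. Qed.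

Lemma norm_cIm_le z : `|cIm z| <= cabs z.
Proof. by rewrite cabsE -sqrtr_sqr ler_wsqrtr// lerDr sqr_ge0. Qed.

Lemma cabs_le z : cabs z <= `|cRe z| + `|cIm z|.
Proof.
rewrite cabsE -(ger0_norm (addr_ge0 (normr_ge0 (cRe z)) (normr_ge0 (cIm z)))).
rewrite -sqrtr_sqr ler_wsqrtr// sqrrD !real_normK ?num_real// addrAC lerDl.
by rewrite mulrn_wge0// mulr_ge0.
Qed.

Lemma L1P (g : R -> C) : L1 g <-> rL1 (cRe \o g) /\ rL1 (cIm \o g).
Proof. by []. Qed.

(** Closedness in [closed_ideal] is measured with the modulus, the estimates with the real and
    imaginary parts; the two norms are equivalent. *)
Lemma L1norm_cRe (g : R -> C) : L1 g ->
  ((L1norm (cRe \o g))%:E <= \int[mu]_x (cabs (g x))%:E)%E /\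
  ((L1norm (cIm \o g))%:E <= \int[mu]_x (cabs (g x))%:E)%E /\
  (\int[mu]_x (cabs (g x))%:E <= (L1norm (cRe \o g) + L1norm (cIm \o g))%:E)%E.
Proof.
move=> [lg1 lg2]; have m1 := rL1_measurable lg1; have m2 := rL1_measurable lg2.
have mc : measurable_fun setT (fun x : T => (cabs (g x))%:E).
  apply/measurable_EFinP; under eq_fun do rewrite cabsE.
  apply: (measurableT_comp (continuous_measurable_fun (@sqrt_continuous R))).
  by apply: measurable_funD; exact: measurable_funX.
split; [|split].
- rewrite EFin_L1norm//; apply: ge0_le_integral => //.
    by apply/measurable_EFinP; exact: measurableT_comp.
  by move=> x _; rewrite lee_fin norm_cRe_le.
- rewrite EFin_L1norm//; apply: ge0_le_integral => //.
    by apply/measurable_EFinP; exact: measurableT_comp.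
  by move=> x _; rewrite lee_fin norm_cIm_le.
rewrite EFinD !EFin_L1norm// -ge0_integralD//; last 2 first.
- by apply/measurable_EFinP; exact: measurableT_comp.
- by apply/measurable_EFinP; exact: measurableT_comp.
apply: ge0_le_integral => //.
- by move=> x _; rewrite lee_fin cabs_ge0.
- by apply: emeasurable_funD; apply/measurable_EFinP; exact: measurableT_comp.
by move=> x _; rewrite -EFinD lee_fin cabs_le.
Qed.

Lemma ccvg_near (u v : R -> C) l : (forall x, 0 <= x -> u x = v x) ->
  ccvg_pinfty u l -> ccvg_pinfty v l.
Proof.
move=> uv [h1 h2].
have h : \forall x \near +oo, u x = v x by near=> x; exact: uv.
split; [apply: cvg_trans h1|apply: cvg_trans h2]; apply: near_eq_cvg;
  by apply: filterS h => x ->.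
Unshelve. all: by end_near. Qed.

Lemma ccvg_unique (u : R -> C) l m : ccvg_pinfty u l -> ccvg_pinfty u m -> l = m.
Proof.
by move=> [l1 l2] [m1 m2]; apply: complexP;
  [exact: (cvg_unique _ l1 m1)|exact: (cvg_unique _ l2 m2)].
Qed.

Lemma ccvgD (u v : R -> C) l m : ccvg_pinfty u l -> ccvg_pinfty v m ->
  ccvg_pinfty (fun x => u x + v x) (l + m).
Proof.
move=> [l1 l2] [m1 m2]; split.
  by rewrite cReD; under eq_fun do rewrite cReD; exact: cvgD.
by rewrite cImD; under eq_fun do rewrite cImD; exact: cvgD.
Qed.

Lemma ccvgZ c (u : R -> C) l : ccvg_pinfty u l ->
  ccvg_pinfty (fun x => c * u x) (c * l).
Proof.
move=> [l1 l2]; split.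
  rewrite cReM; under eq_fun do rewrite cReM.
  by apply: cvgB; (apply: cvgM; [exact: cvg_cst|]).
rewrite cImM; under eq_fun do rewrite cImM.
by apply: cvgD; (apply: cvgM; [exact: cvg_cst|]).
Qed.

(** * Half-line integrals as convolutions on the line *)

Section half_line.
Implicit Types u v f : R -> R.

Definition rstar u x : R := if x < 0 then u (- x) else 0.

Lemma cRe_phistar (phi : R -> C) : cRe \o phistar phi = rstar (cRe \o phi).
Proof. by apply/funext => x; rewrite /= /phistar /rstar; case: ifP. Qed.

Lemma cIm_phistar (phi : R -> C) : cIm \o phistar phi = rstar (cIm \o phi).
Proof. by apply/funext => x; rewrite /= /phistar /rstar; case: ifP. Qed.

Lemma Rplus_measurable : measurable (@Rplus R).
Proof. exact: measurable_itv. Qed.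

Lemma patch_RplusE u x :
  (u \_ Rplus) x = if 0 <= x then u x else 0.
Proof. by rewrite /patch /Rplus mem_setE in_itv/= andbT. Qed.

Lemma rL1_patch_Rplus u : mu.-integrable Rplus (EFin \o u) -> rL1 (u \_ Rplus).
Proof.
move=> /integrable_mkcond => /(_ Rplus_measurable); congr (mu.-integrable _ _).
by apply/funext => x /=; rewrite /patch; case: ifP.
Qed.

Lemma rL1_rstar u : mu.-integrable Rplus (EFin \o u) -> rL1 (rstar u).
Proof.
move=> /rL1_patch_Rplus/rL1_opp lu.
(* The reflected patch has the value [u 0] at 0, where [rstar u] is 0; the indicator removes that
   point. *)
have : rL1 (fun x => \1_(`]-oo, 0[%classic) x * (u \_ Rplus) (- x)).
  apply: (rL1Ml (M := 1) _ _ lu); first exact: measurable_indic.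
  by move=> x; rewrite indicE; case: (_ \in _); rewrite ?normr1 ?normr0.
congr rL1; apply/funext => x; rewrite indicE mem_setE in_itv/= /rstar.
rewrite patch_RplusE oppr_ge0; case: (ltP x 0) => x0; last by rewrite mul0r.
by rewrite mul1r ltW.
Qed.

Section shifted.
Variables (s : R) (s0 : 0 <= s).

Let tail := `[s, +oo[%classic : set R.

Let mtail : measurable tail. Proof. exact: measurable_itv. Qed.

Lemma measurable_tail_product v u : measurable_fun Rplus v ->
  measurable_fun Rplus u ->
  measurable_fun setT ((fun t => v t * u (t - s)) \_ tail).
Proof.
move=> /(measurable_restrictT _ Rplus_measurable) mv.
move=> /(measurable_restrictT _ Rplus_measurable) mu'.
have -> : (fun t => v t * u (t - s)) \_ tail =
    (fun t => (v \_ Rplus) t * (u \_ Rplus) (t - s)) \_ tail.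
  apply/funext => t; rewrite /patch; case: ifPn => //.
  rewrite !mem_setE /Rplus !in_itv/= !andbT => st.
  by rewrite subr_ge0 st (le_trans s0 st).
apply/(measurable_restrictT _ mtail)/measurable_funTS; apply: measurable_funM => //.
exact: (measurableT_comp mu' (measurable_shift (- s))).
Qed.

Lemma Rintegral_tail_shift f : measurable_fun setT (f \_ tail) ->
  \int[mu]_(t in tail) f t = \int[mu]_(t in Rplus) f (t + s).
Proof.
move=> mf; rewrite [LHS]Rintegral_mkcond [RHS]Rintegral_mkcond.
rewrite -[LHS](Rintegral_shift s)//; apply: eq_Rintegral => t _.
by rewrite patch_RplusE /patch mem_setE in_itv/= andbT lerDr.
Qed.

(** For [s < t] the value [rstar u (s - t)] is [u (t - s)], and for [t < s] both integrands vanish.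
    They can differ at [t = s] alone, where [rstar] takes the value 0. *)
Lemma Rintegral_tail_rconv (w : R -> R) u M : measurable_fun setT w ->
  (forall x, `|w x| <= M) -> mu.-integrable Rplus (EFin \o u) ->
  mu.-integrable tail (EFin \o (fun t => w t * u (t - s))) /\
  \int[mu]_(t in tail) (w t * u (t - s)) = rconv (rstar u) w s.
Proof.
move=> mw wM lu; have lu' := rL1_patch_Rplus lu.
have lwu : rL1 (fun t => w t * (u \_ Rplus) (t - s)).
  by apply: (rL1Ml mw wM); exact: (rL1_shift (- s)).
have wuE : (fun t => w t * u (t - s)) \_ tail =
    (fun t => w t * (u \_ Rplus) (t - s)).
  apply/funext => t; rewrite patch_RplusE /patch mem_setE in_itv/= andbT subr_ge0.
  by case: ifP; rewrite ?mulr0.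
split.
  apply/integrable_mkcond => //; move: lwu; rewrite -wuE.
  congr (mu.-integrable _ _).
  by apply/funext => x /=; rewrite /patch; case: ifP.
rewrite [LHS]Rintegral_mkcond wuE; apply: ae_eq_Rintegral => //.
- exact: rL1_measurable.
- by apply: rL1_measurable; apply: rL1_rconv_bounded => //; exact: rL1_rstar.
exists [set s]; split => //; first exact: lebesgue_measure_set1.
move=> t /= h; apply: contrapT => ts; apply: h => _.
rewrite patch_RplusE /rstar subr_lt0 opprB subr_ge0 mulrC lt_neqAle.
by have -> : (s != t) by (apply/eqP => st; apply: ts).
Qed.

End shifted.

Lemma Rintegral_rstar u : mu.-integrable Rplus (EFin \o u) ->
  \int[mu]_x rstar u x = \int[mu]_(x in Rplus) u x.
Proof.
(* The tail identity for [s = 0] and the constant 1. *)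
move=> lu; have [|_] := @Rintegral_tail_rconv 0 (cst 1) u 1
  (measurable_cst _) _ lu; first by move=> x; rewrite normr1.
rewrite -(@Rintegral_reflect _ 0 (rstar u)); last first.
  exact: (rL1_measurable (rL1_rstar lu)).
rewrite /rconv; under [X in _ = X -> _]eq_Rintegral do rewrite mulr1.
by move=> <-; apply: eq_Rintegral => t _; rewrite mul1r subr0.
Qed.

End half_line.
End complex_glue.

(** * Sufficiency: Wiener's closed ideal *)

Section tauberian.
Context {R : realType}.
Local Notation mu := (@lebesgue_measure R).
Local Notation C := R[i].

Section linearity.
Implicit Types f g h w : R -> R.

Lemma rconvDl f g w M x : measurable_fun setT w -> (forall x, `|w x| <= M) ->
  rL1 f -> rL1 g -> rconv (fun x => f x + g x) w x = rconv f w x + rconv g w x.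
Proof.
move=> mw wM lf lg; rewrite /rconv -RintegralD//;
  [|exact: (rL1_rconv_bounded mw wM)..].
by apply: eq_Rintegral => t _; rewrite mulrDl.
Qed.

Lemma rconvZl c f w M x : measurable_fun setT w -> (forall x, `|w x| <= M) ->
  rL1 f -> rconv (fun x => c * f x) w x = c * rconv f w x.
Proof.
move=> mw wM lf; rewrite /rconv -RintegralZl//;
  last exact: (rL1_rconv_bounded mw wM).
by apply: eq_Rintegral => t _; rewrite mulrA.
Qed.

Lemma rconvBl f g w M x : measurable_fun setT w -> (forall x, `|w x| <= M) ->
  rL1 f -> rL1 g -> rconv (fun x => f x - g x) w x = rconv f w x - rconv g w x.
Proof.
move=> mw wM lf lg; rewrite /rconv -RintegralB//;
  [|exact: (rL1_rconv_bounded mw wM)..].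
by apply: eq_Rintegral => t _; rewrite mulrBl.
Qed.

Lemma rconvDr h f g M x : measurable_fun setT f -> (forall x, `|f x| <= M) ->
  measurable_fun setT g -> (forall x, `|g x| <= M) ->
  rL1 h -> rconv h (fun x => f x + g x) x = rconv h f x + rconv h g x.
Proof.
move=> mf fM mg gM lh; rewrite /rconv -RintegralD//;
  [|exact: (rL1_rconv_bounded mf fM)|exact: (rL1_rconv_bounded mg gM)].
by apply: eq_Rintegral => t _; rewrite mulrDr.
Qed.

Lemma rconvBr h f g M x : measurable_fun setT f -> (forall x, `|f x| <= M) ->
  measurable_fun setT g -> (forall x, `|g x| <= M) ->
  rL1 h -> rconv h (fun x => f x - g x) x = rconv h f x - rconv h g x.
Proof.
move=> mf fM mg gM lh; rewrite /rconv -RintegralB//;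
  [|exact: (rL1_rconv_bounded mf fM)|exact: (rL1_rconv_bounded mg gM)].
by apply: eq_Rintegral => t _; rewrite mulrBr.
Qed.

(** Truncation makes the bound valid at every real point, so that the convolution estimates carry no
    exceptional set. Cutting at [|M|] keeps the truncation interval nonempty whatever the sign of
    [M]. *)
Lemma bounded_representative (v : R -> R) (M : R) : measurable_fun Rplus v ->
  {ae mu, forall x, Rplus x -> `|v x| <= M} ->
  exists w, [/\ measurable_fun setT w, forall x, `|w x| <= `|M| &
    {ae mu, forall x, Rplus x -> v x = w x}].
Proof.
move=> mv vM.
exists (fun x => Num.max (- `|M|) (Num.min `|M| ((v \_ Rplus) x))); split.
- apply: measurable_maxr; first exact: measurable_cst.
  apply: measurable_minr; first exact: measurable_cst.
  exact/(measurable_restrictT _ Rplus_measurable).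
- move=> x; rewrite ler_norml le_max lexx/= ge_max ge_min lexx/= andbT.
  by rewrite (@le_trans _ _ 0)// oppr_le0.
apply: (ae_imply vM) => x vxM Rx; rewrite /patch mem_set//.
have := le_trans (vxM Rx) (ler_norm M); rewrite ler_norml => /andP[h1 h2].
by rewrite min_r// max_r.
Qed.

End linearity.

Implicit Types f g h : R -> C.

Definition L1conv (h f : R -> C) : R -> C := fun x => Complex
  (rconv (cRe \o h) (cRe \o f) x - rconv (cIm \o h) (cIm \o f) x)
  (rconv (cRe \o h) (cIm \o f) x + rconv (cIm \o h) (cRe \o f) x).

Lemma L1_L1conv h f : L1 h -> L1 f -> L1 (L1conv h f).
Proof.
move=> [h1 h2] [f1 f2]; split.
  by apply: rL1B; exact: rL1_rconv.
by apply: rL1D; exact: rL1_rconv.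
Qed.

Lemma ae_L1conv h f : L1 h -> L1 f -> {ae mu, forall x, L1conv h f x = Defs.conv h f x}.
Proof.
move=> [h1 h2] [f1 f2].
have := ae_conj (ae_conj (ae_rL1_rconv h1 f1) (ae_rL1_rconv h2 f2))
                (ae_conj (ae_rL1_rconv h1 f2) (ae_rL1_rconv h2 f1)).
move=> /ae_imply; apply=> x [[l11 l22] [l12 l21]]; rewrite /Defs.conv /cint.
congr Complex.
  rewrite /rconv -RintegralB//; apply: eq_Rintegral => t _.
  by rewrite /= cReM.
rewrite /rconv -RintegralD//; apply: eq_Rintegral => t _.
by rewrite /= cImM.
Qed.

Lemma cint_L1conv h f : L1 h -> L1 f ->
  cint setT (L1conv h f) = cint setT h * cint setT f.
Proof.
move=> [h1 h2] [f1 f2]; apply: complexP; rewrite ?cReM ?cImM/=.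
  by rewrite -!Rintegral_rconv// -RintegralB//; exact: rL1_rconv.
by rewrite -!Rintegral_rconv// -RintegralD//; exact: rL1_rconv.
Qed.

Lemma L1D f g : L1 f -> L1 g -> L1 (fun x => f x + g x :> C).
Proof.
move=> [f1 f2] [g1 g2]; split.
  have := rL1D f1 g1; congr rL1; apply/funext => x /=; exact/esym/cReD.
have := rL1D f2 g2; congr rL1; apply/funext => x /=; exact/esym/cImD.
Qed.

Lemma L1Z c f : L1 f -> L1 (fun x => c * f x :> C).
Proof.
move=> [f1 f2]; split.
  have := rL1B (rL1Z (cRe c) f1) (rL1Z (cIm c) f2).
  congr rL1; apply/funext => x /=; exact/esym/cReM.
have := rL1D (rL1Z (cRe c) f2) (rL1Z (cIm c) f1).
congr rL1; apply/funext => x /=; exact/esym/cImM.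
Qed.

Lemma L1B f g : L1 f -> L1 g -> L1 (fun x => f x - g x :> C).
Proof.
move=> lf lg; have := L1D lf (L1Z (-1) lg).
by congr L1; apply/funext => x; rewrite mulN1r.
Qed.

Lemma cintD f g : L1 f -> L1 g ->
  cint setT (fun x => f x + g x) = cint setT f + cint setT g.
Proof.
move=> [f1 f2] [g1 g2]; apply: complexP; rewrite ?cReD ?cImD /=.
  by rewrite -RintegralD//; apply: eq_Rintegral => x _; exact: cReD.
by rewrite -RintegralD//; apply: eq_Rintegral => x _; exact: cImD.
Qed.

Lemma cintZ c f : L1 f -> cint setT (fun x => c * f x) = c * cint setT f.
Proof.
move=> [f1 f2]; apply: complexP; rewrite ?cReM ?cImM /=.
  rewrite -!RintegralZl// -RintegralB//; [|exact: rL1Z..].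
  by apply: eq_Rintegral => x _; exact: cReM.
rewrite -!RintegralZl// -RintegralD//; [|exact: rL1Z..].
by apply: eq_Rintegral => x _; exact: cImM.
Qed.

Section bounded_function.
Variables (w : R -> C) (M : R).
Hypothesis mw1 : measurable_fun setT (cRe \o w).
Hypothesis mw2 : measurable_fun setT (cIm \o w).
Hypothesis wM1 : forall x, `|(cRe \o w) x| <= M.
Hypothesis wM2 : forall x, `|(cIm \o w) x| <= M.

Let M0 : 0 <= M. Proof. exact: le_trans (wM1 0). Qed.

Lemma L1convDl f g x : L1 f -> L1 g ->
  L1conv (fun x => f x + g x) w x = L1conv f w x + L1conv g w x.
Proof.
move=> [f1 f2] [g1 g2]; rewrite /L1conv.
have -> : cRe \o (fun x => f x + g x) = fun x => (cRe \o f) x + (cRe \o g) x.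
  by apply/funext => y; exact: cReD.
have -> : cIm \o (fun x => f x + g x) = fun x => (cIm \o f) x + (cIm \o g) x.
  by apply/funext => y; exact: cImD.
rewrite (rconvDl x mw1 wM1)// (rconvDl x mw2 wM2)//.
rewrite (rconvDl x mw1 wM1)// (rconvDl x mw2 wM2)//.
by apply: complexP; rewrite ?cReD ?cImD /=; ring.
Qed.

Lemma L1convZl c f x : L1 f ->
  L1conv (fun x => c * f x) w x = c * L1conv f w x.
Proof.
move=> [f1 f2]; rewrite /L1conv.
have -> : cRe \o (fun x => c * f x) =
    fun x => cRe c * (cRe \o f) x - cIm c * (cIm \o f) x.
  by apply/funext => y; exact: cReM.
have -> : cIm \o (fun x => c * f x) =
    fun x => cRe c * (cIm \o f) x + cIm c * (cRe \o f) x.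
  by apply/funext => y; exact: cImM.
rewrite (rconvBl x mw1 wM1)//; [|exact: rL1Z..].
rewrite (rconvBl x mw2 wM2)//; [|exact: rL1Z..].
rewrite (rconvDl x mw1 wM1)//; [|exact: rL1Z..].
rewrite (rconvDl x mw2 wM2)//; [|exact: rL1Z..].
do 4 rewrite (rconvZl _ x mw1 wM1)//.
do 4 rewrite (rconvZl _ x mw2 wM2)//.
by apply: complexP; rewrite ?cReM ?cImM /=; ring.
Qed.

Lemma L1convBl f g x : L1 f -> L1 g ->
  L1conv (fun x => f x - g x) w x = L1conv f w x - L1conv g w x.
Proof.
move=> lf lg; have := L1convDl x lf (L1Z (-1) lg).
rewrite (L1convZl (-1) x lg) mulN1r => <-.
by congr (L1conv _ w x); apply/funext => y; rewrite mulN1r.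
Qed.

Lemma norm_L1conv f x : L1 f ->
  `|cRe (L1conv f w x)| <= M * (L1norm (cRe \o f) + L1norm (cIm \o f)) /\
  `|cIm (L1conv f w x)| <= M * (L1norm (cRe \o f) + L1norm (cIm \o f)).
Proof.
move=> [f1 f2]; rewrite mulrDr /=; split.
  apply: le_trans (ler_normB _ _) _.
  by apply: lerD; exact: norm_rconv_bounded.
apply: le_trans (ler_normD _ _) _.
by apply: lerD; exact: norm_rconv_bounded.
Qed.

(** Expands into eight instances of [rconvA], one for each choice of real or imaginary parts of [h],
    [g] and [w]. *)
Lemma L1convA h g x : L1 h -> L1 g ->
  L1conv (L1conv h g) w x = L1conv h (L1conv g w) x.
Proof.
move=> [h1 h2] [g1 g2].
have mr (f v : R -> R) : rL1 f -> measurable_fun setT v ->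
    measurable_fun setT (rconv f v).
  by move=> lf mv; apply: measurable_rconv => //; exact: rL1_measurable.
have br (f v : R -> R) N y : rL1 f -> measurable_fun setT v ->
    (forall x, `|v x| <= M) -> L1norm f <= N -> `|rconv f v y| <= M * N.
  move=> lf mv vM fN; apply: le_trans (norm_rconv_bounded mv vM y lf) _.
  by rewrite ler_wpM2l.
pose N := L1norm (cRe \o g) + L1norm (cIm \o g).
have N1 : L1norm (cRe \o g) <= N by rewrite lerDl L1norm_ge0.
have N2 : L1norm (cIm \o g) <= N by rewrite lerDr L1norm_ge0.
have B11 y := br _ _ _ y g1 mw1 wM1 N1.
have B12 y := br _ _ _ y g1 mw2 wM2 N1.
have B21 y := br _ _ _ y g2 mw1 wM1 N2.
have B22 y := br _ _ _ y g2 mw2 wM2 N2.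
have m11 := mr _ _ g1 mw1; have m12 := mr _ _ g1 mw2.
have m21 := mr _ _ g2 mw1; have m22 := mr _ _ g2 mw2.
rewrite {1}/L1conv [in RHS]/L1conv.
have -> : cRe \o L1conv h g = fun x =>
  rconv (cRe \o h) (cRe \o g) x - rconv (cIm \o h) (cIm \o g) x by [].
have -> : cIm \o L1conv h g = fun x =>
  rconv (cRe \o h) (cIm \o g) x + rconv (cIm \o h) (cRe \o g) x by [].
have -> : cRe \o L1conv g w = fun x =>
  rconv (cRe \o g) (cRe \o w) x - rconv (cIm \o g) (cIm \o w) x by [].
have -> : cIm \o L1conv g w = fun x =>
  rconv (cRe \o g) (cIm \o w) x + rconv (cIm \o g) (cRe \o w) x by [].
rewrite (rconvBl x mw1 wM1)//; [|exact: rL1_rconv..].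
rewrite (rconvBl x mw2 wM2)//; [|exact: rL1_rconv..].
rewrite (rconvDl x mw1 wM1)//; [|exact: rL1_rconv..].
rewrite (rconvDl x mw2 wM2)//; [|exact: rL1_rconv..].
rewrite (rconvBr x m11 B11 m22 B22)//.
rewrite (rconvDr x m12 B12 m21 B21)//.
rewrite (rconvBr x m11 B11 m22 B22)//.
rewrite (rconvDr x m12 B12 m21 B21)//.
do 4 rewrite (rconvA mw1 wM1)//.
do 4 rewrite (rconvA mw2 wM2)//.
by do 8 move: (rconv _ _ x) => ?; congr Complex; ring.
Qed.

Lemma L1conv_cvg h l : L1 h -> ccvg_pinfty w l ->
  ccvg_pinfty (L1conv h w) (cint setT h * l).
Proof.
move=> [h1 h2] [l1 l2]; split.
  rewrite cReM; apply: cvgB; first exact: (rconv_cvg mw1 wM1).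
  exact: (rconv_cvg mw2 wM2).
rewrite cImM; apply: cvgD; first exact: (rconv_cvg mw2 wM2).
exact: (rconv_cvg mw1 wM1).
Qed.

End bounded_function.

Lemma measurable_L1conv h w : L1 h -> measurable_fun setT (cRe \o w) ->
  measurable_fun setT (cIm \o w) ->
  measurable_fun setT (cRe \o L1conv h w) /\
  measurable_fun setT (cIm \o L1conv h w).
Proof.
move=> [h1 h2] mw1 mw2; have m1 := rL1_measurable h1; have m2 := rL1_measurable h2.
split.
  by apply: measurable_funB; exact: measurable_rconv.
by apply: measurable_funD; exact: measurable_rconv.
Qed.

Lemma closed_ideal_tauberian (w : R -> C) (M : R) (a : C) :
  measurable_fun setT (cRe \o w) -> measurable_fun setT (cIm \o w) ->
  (forall x, `|(cRe \o w) x| <= M) -> (forall x, `|(cIm \o w) x| <= M) ->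
  closed_ideal [set g | L1 g /\ ccvg_pinfty (L1conv g w) (a * cint setT g)].
Proof.
move=> mw1 mw2 wM1 wM2.
have L10 : @L1 R (fun=> 0) by split; exact: rL1_0.
split.
- by move=> g [].
- split => //.
  have c0 : cint setT (fun=> 0 : C) = 0.
    by have := cintZ 0 L10; under eq_fun do rewrite mul0r; rewrite mul0r.
  have -> : L1conv (fun=> 0) w = fun=> 0.
    apply/funext => x; have := L1convZl mw1 mw2 wM1 wM2 0 x L10.
    by under eq_fun do rewrite mul0r; rewrite mul0r.
  by rewrite c0 mulr0; split; exact: cvg_cst.
- move=> f g [lf cf] [lg cg]; split; first exact: L1D.
  rewrite cintD// mulrDr; have := ccvgD cf cg; congr ccvg_pinfty.
  by apply/funext => x; rewrite (L1convDl mw1 mw2 wM1 wM2).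
- move=> c f [lf cf]; split; first exact: L1Z.
  rewrite cintZ// mulrCA; have := ccvgZ c cf; congr ccvg_pinfty.
  by apply/funext => x; rewrite (L1convZl mw1 mw2 wM1 wM2).
split.
  (* By associativity, convolving with [h] acts on the already convergent function [L1conv f w], and
     it multiplies the limit by the integral of [h]. *)
  move=> f h [lf cf] lh; exists (L1conv h f); last exact: ae_L1conv.
  split; first exact: L1_L1conv.
  rewrite cint_L1conv// mulrCA.
  have [m1 m2] := measurable_L1conv lf mw1 mw2.
  have := L1conv_cvg m1 m2
    (fun x => (norm_L1conv mw1 mw2 wM1 wM2 x lf).1)
    (fun x => (norm_L1conv mw1 mw2 wM1 wM2 x lf).2) lh cf.
  congr ccvg_pinfty.
  by apply/funext => x; rewrite (L1convA mw1 mw2 wM1 wM2).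
move=> f lf happ; split => //.
have M0 : 0 <= M by exact: le_trans (wM1 0).
have approx e : 0 < e -> exists g, [/\ L1 g, ccvg_pinfty (L1conv g w) (a * cint setT g),
    forall x, `|cRe (L1conv f w x) - cRe (L1conv g w x)| <= e,
    forall x, `|cIm (L1conv f w x) - cIm (L1conv g w x)| <= e &
    `|cRe (a * cint setT f) - cRe (a * cint setT g)| <= e /\
    `|cIm (a * cint setT f) - cIm (a * cint setT g)| <= e].
  (* If both parts of [f - g] have norm below [e / K], the convolutions with [w] differ by at most
     [2 * M * (e / K)], uniformly in [x], and the limits by at most [(|cRe a| + |cIm a|) * (e / K)].
     The summand 1 keeps [K] positive. *)
  move=> e0; pose K := 2 * M + `|cRe a| + `|cIm a| + 1.
  have K0 : 0 < K by rewrite /K; have := normr_ge0 (cRe a); have := normr_ge0 (cIm a); lra.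
  have [g [lg cg] fg] := happ (e / K) (divr_gt0 e0 K0).
  have lfg := L1B lf lg; have [N1 [N2 _]] := L1norm_cRe lfg.
  have := le_lt_trans N1 fg; have := le_lt_trans N2 fg; rewrite !lte_fin.
  move: (L1norm_ge0 (cRe \o (fun x => f x - g x))) (L1norm_ge0 (cIm \o (fun x => f x - g x))).
  set n1 := L1norm (cRe \o _); set n2 := L1norm (cIm \o _) => n10 n20 h2 h1.
  have eK : e = (e / K) * K by rewrite divfK// gt_eqF.
  have bM : M * (n1 + n2) <= e.
    rewrite eK; apply: (@le_trans _ _ (M * ((e / K) + (e / K)))).
      by apply: ler_wpM2l => //; apply: lerD; exact: ltW.
    rewrite (_ : M * _ = e / K * (2 * M)); last by ring.
    rewrite ler_pM2l ?divr_gt0//.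
    by rewrite /K; have := normr_ge0 (cRe a); have := normr_ge0 (cIm a); lra.
  have ba (p q : R) : `|p| <= e / K -> `|q| <= e / K ->
      `|cRe a * p| + `|cIm a * q| <= e.
    move=> hp hq; rewrite !normrM eK.
    apply: (@le_trans _ _ (`|cRe a| * (e / K) + `|cIm a| * (e / K))).
      by apply: lerD; apply: ler_wpM2l.
    rewrite -mulrDl mulrC; apply: ler_wpM2l; first by rewrite divr_ge0// ltW.
    by rewrite /K; lra.
  have intB : cint setT f - cint setT g = cint setT (fun x => f x - g x).
    rewrite -mulN1r -cintZ// -cintD//; last exact: L1Z.
    by congr cint; apply/funext => x; rewrite mulN1r.
  have i1 : `|cRe (cint setT (fun x => f x - g x))| <= e / K.
    exact: le_trans (norm_Rintegral_le lfg.1) (ltW h1).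
  have i2 : `|cIm (cint setT (fun x => f x - g x))| <= e / K.
    exact: le_trans (norm_Rintegral_le lfg.2) (ltW h2).
  exists g; split => //; last split.
  - move=> x; rewrite -cReB -(L1convBl mw1 mw2 wM1 wM2)//.
    exact: le_trans (norm_L1conv mw1 mw2 wM1 wM2 x lfg).1 bM.
  - move=> x; rewrite -cImB -(L1convBl mw1 mw2 wM1 wM2)//.
    exact: le_trans (norm_L1conv mw1 mw2 wM1 wM2 x lfg).2 bM.
  - rewrite -cReB -mulrBr intB cReM; apply: le_trans (ler_normB _ _) _.
    exact: ba.
  - rewrite -cImB -mulrBr intB cImM; apply: le_trans (ler_normD _ _) _.
    exact: ba.
have tri (u u' v v' e : R) : `|u - u'| <= e / 4 -> `|v - v'| <= e / 4 ->
    `|u' - v'| < e / 4 -> 0 < e -> `|u - v| < e.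
  by rewrite !ler_norml !ltr_norml => /andP[? ?] /andP[? ?] /andP[? ?] ?;
    apply/andP; split; lra.
split; apply/cvgrPdist_lt => e e0; have e4 : 0 < e / 4 by rewrite divr_gt0.
- have [g [lg [/cvgrPdist_lt cg _] h1 h2 [h3 h4]]] := approx (e / 4) e4.
  have := cg (e / 4) e4; apply: filterS => x hx.
  exact: (tri _ _ _ _ e h3 (h1 x) hx e0).
- have [g [lg [_ /cvgrPdist_lt cg] h1 h2 [h3 h4]]] := approx (e / 4) e4.
  have := cg (e / 4) e4; apply: filterS => x hx.
  exact: (tri _ _ _ _ e h4 (h2 x) hx e0).
Qed.

End tauberian.

(** * Bounded functionals and step functions *)

Section intervals.
Context {R : realType}.
Local Notation mu := (@lebesgue_measure R).
Local Notation T := (measurableTypeR R).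
Implicit Types f g h psi : R -> R.

(** Half-open intervals: indicators of adjacent ones add up exactly, without discarding
    endpoints. *)
Definition oc (a b : R) : R -> R := \1_(`]a, b]%classic).

Lemma ocE a b x : a <= b -> oc a b x = (a < x)%R%:R - (b < x)%R%:R.
Proof.
move=> ab; rewrite /oc indicE mem_setE in_itv/= leNgt.
have [bx|] := ltP b x; last by case: ltP; rewrite ?subr0.
by rewrite (le_lt_trans ab bx)/= subrr.
Qed.

Lemma oc_cases a b x : oc a b x = 1 /\ a < x <= b \/ oc a b x = 0 /\ ~ a < x <= b.
Proof.
rewrite /oc indicE mem_setE in_itv/=.
by case: (boolP (a < x <= b)); [left|right].
Qed.

Lemma norm_oc_le1 a b x : `|oc a b x| <= 1.
Proof. by have [[-> _]|[-> _]] := oc_cases a b x; rewrite ?normr1 ?normr0. Qed.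

Lemma oc_chasles a b c x : a <= b -> b <= c -> oc a c x = oc a b x + oc b c x.
Proof. by move=> ab bc; rewrite !ocE//; [lra|exact: le_trans bc]. Qed.

Lemma oc_shift a b t x : oc a b (x - t) = oc (a + t) (b + t) x.
Proof.
by rewrite /oc !indicE !mem_setE !in_itv/= ltrBrDr lerBlDr.
Qed.

Lemma measurable_oc a b : measurable_fun setT (oc a b).
Proof. exact: measurable_indic. Qed.

Lemma rL1_oc a b : rL1 (oc a b).
Proof. exact: rL1_indic_itv. Qed.

Lemma Rintegral_oc a b : a <= b -> \int[mu]_x oc a b x = b - a.
Proof.
move=> ab; rewrite /Rintegral /oc integral_indic// setIT.
transitivity (fine (if (a%:E < b%:E)%E then (b%:E - a%:E)%E else 0%E)).
  by congr fine; exact: (lebesgue_measure_itv `]a, b]%R).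
by rewrite lte_fin lt_neqAle ab andbT; case: eqVneq => [->|]//=; rewrite subrr.
Qed.

Lemma L1norm_oc a b : a <= b -> L1norm (oc a b) = b - a.
Proof.
move=> ab; rewrite -(Rintegral_oc ab); apply: eq_Rintegral => x _.
by have [[-> _]|[-> _]] := oc_cases a b x; rewrite ?normr1 ?normr0.
Qed.

Lemma rL1_restr f a b : rL1 f -> rL1 (fun x => oc a b x * f x).
Proof. exact: (rL1Ml (measurable_oc a b) (norm_oc_le1 a b)). Qed.

Lemma rL1_restr_integrable f a b : mu.-integrable `]a, b]%classic (EFin \o f) ->
  rL1 (fun x => oc a b x * f x).
Proof.
move=> /integrable_mkcond => /(_ (measurable_itv _)); congr (mu.-integrable _ _).
apply/funext => x /=; rewrite /patch mem_setE in_itv/=.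
have [[-> ->]|[-> /negP/negbTE ->]] := oc_cases a b x.
  by rewrite mul1r.
by rewrite mul0r.
Qed.

Lemma L1norm_restr f a b : mu.-integrable `]a, b]%classic (EFin \o f) ->
  L1norm (fun x => oc a b x * f x) = \int[mu]_(x in `]a, b]) `|f x|.
Proof.
move=> lf; rewrite /L1norm [RHS]Rintegral_mkcond; apply: eq_Rintegral => x _.
rewrite /patch mem_setE in_itv/=.
have [[-> ->]|[-> /negP/negbTE ->]] := oc_cases a b x.
  by rewrite mul1r.
by rewrite mul0r normr0.
Qed.

Lemma L1norm_restr_chasles f a b c : rL1 f -> a <= b -> b <= c ->
  L1norm (fun x => oc a c x * f x) =
  L1norm (fun x => oc a b x * f x) + L1norm (fun x => oc b c x * f x).
Proof.
move=> lf ab bc; rewrite /L1norm -RintegralD//; [|exact/rL1_norm/rL1_restr..].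
apply: eq_Rintegral => x _; rewrite (oc_chasles _ ab bc).
have [[-> /andP[ax xb]]|[-> _]] := oc_cases a b x; last by rewrite mul0r normr0 !add0r.
have [[-> /andP[bx _]]|[-> _]] := oc_cases b c x; last by rewrite mul0r normr0 !addr0.
by have := le_lt_trans xb bx; rewrite ltxx.
Qed.

Lemma L1norm_tail_cvg f : rL1 f ->
  L1norm (fun x => f x - oc (- n%:R) n%:R x * f x) @[n --> \oo] --> (0 : R).
Proof.
move=> lf.
have -> : 0 = \int[mu]_x (cst 0 x) :> R by rewrite Rintegral_cst// mul0r.
apply: (@Rintegral_dominated_cvg _ _ (cst 0) (fun x => `|f x|)).
- move=> n; apply: rL1_measurable; apply: rL1_norm.
  by apply: rL1B => //; exact: rL1_restr.
- exact: rL1_norm.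
- move=> n x; rewrite normr_id.
  by have [[-> _]|[-> _]] := oc_cases (- n%:R) n%:R x;
    rewrite ?mul1r ?mul0r ?subrr ?subr0 ?normr0.
move=> x; apply: cvg_near_cst; near=> n.
have [[-> _]|[_ h]] := oc_cases (- n%:R) n%:R x.
  by rewrite mul1r subrr normr0.
exfalso; apply: h.
have : `|x| < n%:R by near: n; exact: nbhs_infty_gtr.
by rewrite ltr_norml => /andP[-> /ltW ->].
Unshelve. all: by end_near. Qed.

(* A supremum argument in place of the mean value theorem. *)
Lemma small_increments_eq (E P : R -> R) (a b : R) : a <= b ->
  (forall e x, 0 < e -> a <= x <= b -> exists2 d, 0 < d &
     forall s t, a <= s -> s <= x -> x <= t -> t <= b -> t - s < d ->
       `|E t - E s| <= e * (P t - P s)) ->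
  E b = E a.
Proof.
move=> ab EP.
suff h e : 0 < e -> `|E b - E a| <= e * (P b - P a).
  apply/eqP; rewrite -subr_eq0 -normr_le0; apply/ler_addgt0Pr => e e0.
  rewrite add0r; have Pab : 0 <= P b - P a.
    by have := h _ ltr01; rewrite mul1r; exact: le_trans.
  have d0 : 0 < P b - P a + 1 by lra.
  apply: le_trans (h (e / (P b - P a + 1)) (divr_gt0 e0 d0)) _.
  by rewrite mulrAC ler_pdivrMr// ler_pM2l//; lra.
move=> e0; pose S := [set s | a <= s <= b /\ `|E s - E a| <= e * (P s - P a)].
have Sa : S a by rewrite /S/= lexx ab !subrr normr0 mulr0.
have ubS : ubound S b by move=> s [/andP[]].
have hasS : has_sup S by split; [exists a|exists b].
have cb : sup S <= b by apply: ge_sup => //; exists a.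
have ac : a <= sup S by apply: ub_le_sup => //; exists b.
have [|d d0 hd] := EP e (sup S) e0; first by rewrite ac.
have [|s Ss cs] := @sup_adherent _ S (d / 2) _ hasS; first by rewrite divr_gt0.
have sc : s <= sup S by apply: ub_le_sup => //; exists b.
(* [t] lies beyond [sup S] unless it is [b]. Since [sup S - s < d / 2] and [t - sup S <= d / 3], the
   local bound applies to [s] and [t]. *)
pose t := Num.min b (sup S + d / 3).
have ct : sup S <= t by rewrite le_min cb/= lerDl divr_ge0// ltW.
have tb : t <= b by rewrite ge_min lexx.
have td : t <= sup S + d / 3 by rewrite ge_min lexx orbT.
have [/andP[as_ sb] hs] := Ss.
have St : S t.
  split; first by rewrite tb andbT (le_trans ac).
  have h : `|E t - E s| <= e * (P t - P s) by apply: hd => //; lra.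
  rewrite (_ : E t - E a = (E t - E s) + (E s - E a)); last by lra.
  by apply: le_trans (ler_normD _ _) _; lra.
have tc : t <= sup S by apply: ub_le_sup => //; exists b.
have bt : t = b.
  move: tc; rewrite /t; case: (leP b (sup S + d / 3)) => // _ tc.
  by exfalso; lra.
by have [_] := St; rewrite bt.
Qed.

(** * Vanishing of bounded additive functionals *)

Section bounded_functional.
Variables (L : (R -> R) -> R) (C : R).
Hypothesis LD : forall f g, rL1 f -> rL1 g ->
  L (fun x => f x + g x) = L f + L g.
Hypothesis LC : forall f, rL1 f -> `|L f| <= C * L1norm f.

Lemma functional0 : L (fun=> 0) = 0.
Proof.
have := LD (rL1_0 (R := R)) (rL1_0 (R := R)).
by under eq_fun do rewrite addr0; lra.
Qed.

(** By additivity, [L (oc s t * psi)] is the increment of [s |-> L (oc a s * psi)], which is 0 at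
    [a]. The control [P] is the identity in one application and the L1 mass of [psi] up to [s] in
    the other, where [L] is an error functional. *)
Lemma functional_subdivision psi P a b :
  (forall a b, rL1 (fun x => oc a b x * psi x)) -> a <= b ->
  (forall e x, 0 < e -> a <= x <= b -> exists2 d, 0 < d &
     forall s t, a <= s -> s <= x -> x <= t -> t <= b -> t - s < d ->
       `|L (fun y => oc s t y * psi y)| <= e * (P t - P s)) ->
  L (fun x => oc a b x * psi x) = 0.
Proof.
move=> lpsi ab h.
rewrite (@small_increments_eq (fun s => L (fun x => oc a s x * psi x)) P a b)//.
  rewrite -[RHS]functional0; congr L; apply/funext => x.
  by rewrite ocE// subrr mul0r.
move=> e x e0 axb; have [d d0 hd] := h e x e0 axb; exists d => // s t as_ sx xt tb ts.
have -> : (fun x => oc a t x * psi x) =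
    (fun x => oc a s x * psi x + oc s t x * psi x).
  by apply/funext => y; rewrite (@oc_chasles a s t)// ?mulrDl//; exact: le_trans xt.
by rewrite LD// addrAC subrr add0r; exact: hd.
Qed.

Lemma functional_tail psi : rL1 psi ->
  (forall a b, a <= b -> L (fun x => oc a b x * psi x) = 0) -> L psi = 0.
Proof.
move=> lpsi h0; apply/eqP; rewrite -normr_le0.
have h : C * L1norm (fun x => psi x - oc (- n%:R) n%:R x * psi x) @[n --> \oo] -->
    C * 0 by apply: cvgM; [exact: cvg_cst|exact: L1norm_tail_cvg].
rewrite -(mulr0 C) -(cvg_lim (@Rhausdorff R) h).
apply: limr_ge; first by apply/cvg_ex; exists (C * 0).
apply: nearW => n; have lr := rL1_restr (- n%:R) n%:R lpsi.
apply: le_trans (LC (rL1B lpsi lr)).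
have {1}-> : psi = (fun x => (psi x - oc (- n%:R) n%:R x * psi x) +
    oc (- n%:R) n%:R x * psi x) by apply/funext => x; rewrite subrK.
have nn : - n%:R <= n%:R :> R by rewrite (@le_trans _ _ 0)// oppr_le0.
by rewrite LD//; [rewrite h0// addr0|exact: rL1B].
Qed.

End bounded_functional.

Section functional.
Variables (L : (R -> R) -> R).
Hypothesis LD : forall f g, rL1 f -> rL1 g ->
  L (fun x => f x + g x) = L f + L g.
Hypothesis LZ : forall c f, rL1 f -> L (fun x => c * f x) = c * L f.
Hypothesis Lnorm : forall f, rL1 f -> `|L f| <= L1norm f.

Let LC f : rL1 f -> `|L f| <= 1 * L1norm f.
Proof. by rewrite mul1r; exact: Lnorm. Qed.

Lemma functionalB f g : rL1 f -> rL1 g ->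
  L (fun x => f x - g x) = L f - L g.
Proof.
move=> lf lg; rewrite (LD lf (rL1N lg)); congr (_ + _).
by under eq_fun do rewrite -mulN1r; rewrite LZ// mulN1r.
Qed.

(** On a short interval around [x], [c] may be replaced by [c - c x] because [L] kills the
    indicator; the result has norm at most [e] times the length. *)
Lemma functional_step_continuous (c : R -> R) : continuous c ->
  (forall a b, a <= b -> L (oc a b) = 0) ->
  forall a b, a <= b -> L (fun x => oc a b x * c x) = 0.
Proof.
move=> cc h0 a b ab.
have lc s t : rL1 (fun x => oc s t x * c x).
  apply: rL1_restr_integrable; have cs : {within `[s, t], continuous c}.
    exact: continuous_subspaceT.
  have := continuous_compact_integrable (@segment_compact _ s t) cs.
  by apply: integrableS => //; exact: subset_itv_oc_cc.
apply: (@functional_subdivision L LD c id) => // e x e0 _.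
have /cvgrPdist_le/(_ e e0)/nbhs_ballP[d /= d0 hd] := cc x.
exists d => // s t _ sx xt _ ts.
have -> : (fun y => oc s t y * c y) =
    (fun y => oc s t y * (c y - c x) + c x * oc s t y).
  by apply/funext => y; lra.
have lB : rL1 (fun y => oc s t y * (c y - c x)).
  have := rL1B (lc s t) (rL1Z (c x) (rL1_oc s t)).
  by congr rL1; apply/funext => y; lra.
have st := le_trans sx xt.
rewrite LD//; last exact/rL1Z/rL1_oc.
rewrite LZ ?h0 ?mulr0 ?addr0//; last exact: rL1_oc.
apply: le_trans (Lnorm lB) _; rewrite -(Rintegral_oc st) -RintegralZl//; last exact: rL1_oc.
apply: L1norm_le => //; first exact/rL1Z/rL1_oc.
move=> y; have [[-> /andP[sy yt]]|[-> _]] := oc_cases s t y; last first.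
  by rewrite mul0r mulr0 normr0.
rewrite mul1r mulr1 distrC; apply: hd; rewrite /ball/= ltr_norml; lra.
Qed.

(** Continuous functions approximate [psi] in L1 on each bounded interval. Contraposed, a nonzero
    functional is nonzero on some interval, which is how a nonzero window is found. *)
Lemma functional_step_eq0 : (forall a b, a <= b -> L (oc a b) = 0) ->
  forall psi, rL1 psi -> L psi = 0.
Proof.
move=> h0 psi lpsi; apply: (functional_tail LD LC lpsi) => a b ab.
apply/eqP; rewrite -normr_le0; apply/ler_addgt0Pr => e e0; rewrite add0r.
have mab : (mu `]a, b]%classic < +oo)%E.
  by rewrite lebesgue_measure_itv/=; case: ifP => _; rewrite ?ltry.
have lab : mu.-integrable `]a, b]%classic (EFin \o psi).
  exact: (@integrableS _ _ _ mu setT).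
have [c_ [cc lc_ c_cvg]] := approximation_continuous_integrable
  (measurable_itv _) mab lab.
have /fine_cvg/cvgrPdist_lt/(_ e e0)[n _ /(_ n (leqnn n))] := c_cvg.
rewrite /= sub0r normrN => hn.
have lc := rL1_restr_integrable (lc_ n).
have lB : rL1 (fun x => oc a b x * (psi x - c_ n x)).
  have := rL1B (rL1_restr a b lpsi) lc.
  by congr rL1; apply/funext => y; rewrite mulrBr.
have -> : L (fun x => oc a b x * psi x) = L (fun x => oc a b x * (psi x - c_ n x)).
  rewrite -[RHS]addr0 -(functional_step_continuous (cc n) h0 ab) -LD//.
  by congr L; apply/funext => y; lra.
apply: le_trans (Lnorm lB) _.
have lBab : mu.-integrable `]a, b]%classic (EFin \o (fun x => psi x - c_ n x)).
  exact: (@integrableB _ T R mu _ (measurable_itv _) _ _ lab (lc_ n)).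
rewrite L1norm_restr//; apply: le_trans (ltW hn); exact: ler_norm.
Qed.

(** * Windows of a functional and their pairing with L1 *)

Section exchange.
Variables (d : R) (d0 : 0 <= d).

(** If [L] were integration against a bounded density, this would be the integral of the density
    over (x, x + d]. *)
Definition window (x : R) : R := L (oc x (x + d)).

Let winD x : x <= x + d. Proof. by rewrite lerDl. Qed.

Lemma norm_window x : `|window x| <= d.
Proof. by apply: le_trans (Lnorm (rL1_oc _ _)) _; rewrite L1norm_oc// addrAC subrr add0r. Qed.

Let oc_diff x y z : x <= y ->
  oc x (x + d) z - oc y (y + d) z = oc x y z - oc (x + d) (y + d) z.
Proof. by move=> xy; rewrite !ocE//; lra. Qed.

(** Moving an interval changes it at its two ends, each time by length [|x - y|]. The identity
    [oc_diff] is signed, so it also covers disjoint intervals. *)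
Lemma L1norm_oc_diff x y :
  L1norm (fun z => oc x (x + d) z - oc y (y + d) z) <= 2 * `|x - y|.
Proof.
wlog xy : x y / x <= y.
  move=> hw; have [|/ltW] := leP x y; first exact: hw.
  move=> /hw; rewrite (distrC y); apply: le_trans; rewrite le_eqVlt.
  by apply/orP; left; apply/eqP; apply: eq_Rintegral => z _; rewrite distrC.
have -> : (fun z => oc x (x + d) z - oc y (y + d) z) =
    (fun z => oc x y z + (-1) * oc (x + d) (y + d) z).
  by apply/funext => z; rewrite oc_diff// mulN1r.
apply: le_trans (L1normD (rL1_oc _ _) (rL1Z _ (rL1_oc _ _))) _.
rewrite L1normZ; last exact: rL1_oc.
rewrite !L1norm_oc ?lerD2r// normrN1 mul1r distrC ger0_norm ?subr_ge0//.
by rewrite le_eqVlt; apply/orP; left; apply/eqP; lra.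
Qed.

Lemma window_lipschitz x y : `|window x - window y| <= 2 * `|x - y|.
Proof.
rewrite /window -functionalB; [|exact: rL1_oc..].
by apply: le_trans (L1norm_oc_diff x y); apply: Lnorm; apply: rL1B; exact: rL1_oc.
Qed.

Lemma window_continuous : continuous window.
Proof.
move=> x; apply/cvgrPdist_lt => e e0; near=> y.
apply: le_lt_trans (window_lipschitz _ _) _.
rewrite -ltr_pdivlMl//; near: y.
by apply/nbhs_ballP; exists (2^-1 * e) => //=; rewrite mulr_gt0.
Unshelve. all: by end_near. Qed.

(* The functional commutes with the vector-valued integral
   [\int psi(t) 1_(a + t, a + t + d] dt], by subdividing the range of t. *)
Lemma functional_rconv a psi : rL1 psi ->
  L (rconv (oc a (a + d)) psi) = \int[mu]_t (window (a + t) * psi t).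
Proof.
have mw : measurable_fun setT (fun t => window (a + t)).
  under eq_fun do rewrite addrC.
  exact: (measurableT_comp (continuous_measurable_fun window_continuous)
    (measurable_shift a)).
have lw f : rL1 f -> rL1 (fun t => window (a + t) * f t).
  exact: (rL1Ml mw (fun t => norm_window (a + t))).
pose h := oc a (a + d).
have lh : rL1 h by exact: rL1_oc.
have hE t y : h (y - t) = oc (a + t) (a + t + d) y.
  by rewrite /h oc_shift addrAC.
have lhf f y : rL1 f -> rL1 (fun t => h (y - t) * f t).
  move=> lf; apply: (rL1Ml (M := 1) _ _ lf).
    by apply: measurable_reflect; exact: measurable_oc.
  by move=> t; exact: norm_oc_le1.
(* The error of the exchange is itself additive and bounded, so it suffices that it vanishes on
   bounded intervals. *)
pose e f := L (rconv h f) - \int[mu]_t (window (a + t) * f t).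
move=> lpsi; suff : e psi = 0 by move/eqP; rewrite subr_eq0 => /eqP.
have eD f g : rL1 f -> rL1 g -> e (fun x => f x + g x) = e f + e g.
  move=> lf lg; rewrite /e.
  have -> : rconv h (fun x => f x + g x) = fun x => rconv h f x + rconv h g x.
    apply/funext => y; rewrite /rconv -RintegralD//; [|exact: lhf..].
    by apply: eq_Rintegral => t _; rewrite mulrDr.
  rewrite LD; [|exact: rL1_rconv..].
  under eq_Rintegral do rewrite mulrDr.
  by rewrite RintegralD//; [lra|exact: lw..].
have eC f : rL1 f -> `|e f| <= (2 * d) * L1norm f.
  move=> lf; apply: le_trans (ler_normB _ _) _.
  have := le_trans (Lnorm (rL1_rconv lh lf)) (L1norm_rconv lh lf).
  rewrite /h L1norm_oc// (addrAC a) subrr add0r.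
  have : `|\int[mu]_t (window (a + t) * f t)| <= d * L1norm f.
    apply: le_trans (norm_Rintegral_le (lw _ lf)) _.
    rewrite /L1norm -RintegralZl//; last exact: rL1_norm.
    apply: le_Rintegral => //; [exact/rL1_norm/lw|exact/rL1Z/rL1_norm|].
    by move=> t _; rewrite normrM ler_wpM2r// norm_window.
  by lra.
apply: (functional_tail eD eC lpsi) => u v uv.
pose P s := L1norm (fun x => oc u s x * psi x).
apply: (@functional_subdivision e eD psi P) => //.
  by move=> *; exact: rL1_restr.
(* On a piece of length [t - s] both sides are compared with [window (a + x)] times the integral of
   [f]. Each comparison costs [2 * (t - s) * L1norm f], whence the 4. *)
move=> eps x eps0 /andP[ux xv]; exists (eps / 4); first by rewrite divr_gt0.
move=> s t us sx xt tv ts; have st := le_trans sx xt.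
have -> : P t - P s = L1norm (fun x => oc s t x * psi x).
  by rewrite /P (@L1norm_restr_chasles psi u s t)//; lra.
set f := fun y => oc s t y * psi y; have lf : rL1 f by exact: rL1_restr.
have f_supp y : f y != 0 -> `|y - x| <= t - s.
  rewrite /f; have [[_ /andP[sy yt]] _|[-> _]] := oc_cases s t y.
    by rewrite ler_norml; lra.
  by rewrite mul0r eqxx.
have lb : rL1 (fun y => 2 * (t - s) * `|f y|) by exact/rL1Z/rL1_norm.
(* The difference is an integral of [f r] times the difference of two translates of [h]. On the
   support of [f] these translates are within [2 * (t - s)] in L1, so Minkowski's inequality
   applies. *)
have e1 : `|L (rconv h f) - (\int[mu]_y f y) * window (a + x)| <=
    2 * (t - s) * L1norm f.
  pose k y r := (h (y - r) - h (y - x)) * f r.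
  have mk : measurable_fun setT (fun z : T * T => k z.1 z.2).
    have mh : measurable_fun setT h by exact: measurable_oc.
    apply: measurable_funM.
      apply: measurable_funB.
        by apply: (measurableT_comp mh); exact: measurable_funB.
      by apply: (measurableT_comp mh); exact: measurable_funB.
    by apply: measurableT_comp => //; exact: rL1_measurable.
  have lk r : rL1 (k^~ r).
    rewrite /k; under eq_fun do rewrite mulrC.
    by apply/rL1Z/rL1B; exact: (rL1_shift (- _)).
  have kb r : L1norm (k^~ r) <= 2 * (t - s) * `|f r|.
    have -> : k^~ r = fun y => f r * (h (y - r) - h (y - x)).
      by apply/funext => y; rewrite mulrC.
    rewrite L1normZ; last by apply: rL1B; exact: (rL1_shift (- _)).
    rewrite mulrC; have [->|/f_supp rx] := eqVneq (f r) 0.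
      by rewrite normr0 !mulr0.
    rewrite ler_wpM2r//.
    have -> : (fun y => h (y - r) - h (y - x)) =
        (fun y => oc (a + r) (a + r + d) y - oc (a + x) (a + x + d) y).
      by apply/funext => y; rewrite !hE.
    apply: le_trans (L1norm_oc_diff _ _) _; rewrite ler_pM2l//.
    by rewrite opprD addrACA subrr add0r.
  have -> : window (a + x) = L (fun y => h (y - x)).
    by congr L; apply/funext => y; rewrite hE.
  have lhx : rL1 (fun y => h (y - x)) by exact: (rL1_shift (- x)).
  rewrite -LZ// -functionalB//; [|exact: rL1_rconv|exact: rL1Z].
  have -> : (fun y => rconv h f y - (\int[mu]_y f y) * h (y - x)) =
      (fun y => \int[mu]_r k y r).
    apply/funext => y; rewrite mulrC -RintegralZl// -RintegralB//.
    - by apply: eq_Rintegral => r _; rewrite /k mulrBl.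
    - exact: lhf.
    - exact: rL1Z.
  apply: le_trans (Lnorm (rL1_fubini mk lk kb lb)) _.
  apply: le_trans (L1norm_fubini mk lk kb lb) _.
  by rewrite RintegralZl//; exact: rL1_norm.
have e2 : `|(\int[mu]_y f y) * window (a + x) -
    \int[mu]_r (window (a + r) * f r)| <= 2 * (t - s) * L1norm f.
  rewrite mulrC -RintegralZl// -RintegralB//; [|exact: rL1Z|exact: lw].
  rewrite /L1norm -RintegralZl//; last exact: rL1_norm.
  have lD : rL1 (fun r => window (a + x) * f r - window (a + r) * f r).
    by apply: rL1B; [exact: rL1Z|exact: lw].
  apply: le_trans (norm_Rintegral_le lD) _.
  apply: le_Rintegral => //; first exact: rL1_norm.
  move=> r _; rewrite -mulrBl normrM.
  have [->|/f_supp rx] := eqVneq (f r) 0; first by rewrite normr0 !mulr0.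
  rewrite ler_wpM2r//; apply: le_trans (window_lipschitz _ _) _.
  by rewrite ler_pM2l// opprD addrACA subrr add0r distrC.
have tri : `|e f| <= 2 * (t - s) * L1norm f + 2 * (t - s) * L1norm f.
  rewrite (_ : e f = (L (rconv h f) - (\int[mu]_y f y) * window (a + x)) +
    ((\int[mu]_y f y) * window (a + x) - \int[mu]_r (window (a + r) * f r))).
    by apply: le_trans (ler_normD _ _) _; exact: lerD.
  by rewrite /e; lra.
apply: le_trans tri _; rewrite -mulrDl ler_wpM2r ?L1norm_ge0//.
by lra.
Qed.

End exchange.
End functional.
End intervals.

(** * Gliding humps *)

Section gliding_hump.
Context {R : realType}.
Local Notation mu := (@lebesgue_measure R).
Implicit Types (y z t : R) (H : R -> R).

Let fl y : R := (Num.floor y)%:~R.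

(** The distance from [y] to the nearest integer. *)
Definition tent y : R := Num.min (y - fl y) (1 - (y - fl y)).

Definition center y : R := (fl y + 2^-1) ^+ 2.

(* Copies of H centred at the points (n + 1/2)^2 and modulated by the slowly
   varying factor tent (sqrt t), which vanishes at the points n^2 where the copies meet. *)
Definition glide H t : R := tent (Num.sqrt t) * H (t - center (Num.sqrt t)).

Let fl_itv y : fl y <= y < fl y + 1.
Proof. by have := floor_itv y; rewrite intrD. Qed.

Let fl_step y z : y <= z -> fl y <> fl z -> fl y + 1 <= fl z.
Proof.
move=> yz fyz; rewrite /fl -[1]/(1%:~R) -intrD ler_int lezD1 lt_neqAle.
apply/andP; split; first by apply/eqP => h; apply: fyz; rewrite /fl h.
exact: le_floor.
Qed.

Lemma tent_ge0 y : 0 <= tent y.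
Proof. by have /andP[h1 h2] := fl_itv y; rewrite le_min; apply/andP; split; lra. Qed.

Lemma tent_le_half y : tent y <= 2^-1.
Proof.
by have /andP[h1 h2] := fl_itv y; rewrite ge_min; apply/orP;
  have [h|h] := leP (y - fl y) 2^-1; [left|right; lra].
Qed.

(** Within one unit cell the center is constant and [tent] is 1-Lipschitz. Otherwise an integer lies
    between [y] and [z], so both factors are at most [z - y] and the jump of the center does no
    harm. *)
Lemma tent_modulation H B t y z : (forall x, `|H x| <= B) -> y <= z ->
  `|tent z * H (t - center z) - tent y * H (t - center y)| <= 2 * B * (z - y).
Proof.
move=> HB yz; have B0 : 0 <= B by exact: le_trans (HB 0).
have [fyz|fyz] := eqVneq (fl y) (fl z).
  rewrite /center -fyz -mulrBl normrM.
  have h : `|tent z - tent y| <= z - y.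
    rewrite /tent -fyz ler_norml; set p := y - fl y; set q := z - fl y.
    have -> : z - y = q - p by rewrite /p /q; lra.
    have pq : p <= q by rewrite /p /q; lra.
    by case: (leP p (1 - p)) => ?; case: (leP q (1 - q)) => ?; apply/andP; split; lra.
  apply: le_trans (ler_pM (normr_ge0 _) (normr_ge0 _) h (HB _)) _.
  by have : 0 <= B * (z - y); [rewrite mulr_ge0// subr_ge0|lra].
have {fyz} := fl_step yz (elimN eqP fyz).
have /andP[y1 y2] := fl_itv y; have /andP[z1 z2] := fl_itv z => fyz.
have ty : tent y <= z - y by rewrite /tent ge_min; apply/orP; right; lra.
have tz : tent z <= z - y by rewrite /tent ge_min; apply/orP; left; lra.
apply: le_trans (ler_normB _ _) _; rewrite !normrM !(ger0_norm (tent_ge0 _)).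
have h1 := ler_pM (tent_ge0 z) (normr_ge0 _) tz (HB (t - center z)).
have h2 := ler_pM (tent_ge0 y) (normr_ge0 _) ty (HB (t - center y)).
by have := lerD h1 h2; lra.
Qed.

Lemma norm_tent_mul H B t y : (forall x, `|H x| <= B) ->
  `|tent y * H t| <= 2^-1 * B.
Proof.
move=> HB; rewrite normrM (ger0_norm (tent_ge0 _)).
by apply: ler_pM => //; [exact: tent_ge0|exact: tent_le_half].
Qed.

Let measurable_fl : measurable_fun setT fl.
Proof.
apply: nondecreasing_measurable => // y z yz.
by rewrite /fl ler_int; exact: le_floor.
Qed.

Lemma measurable_glide H : measurable_fun setT H -> measurable_fun setT (glide H).
Proof.
move=> mH; have ms : measurable_fun setT (@Num.sqrt R).
  exact: (continuous_measurable_fun (@sqrt_continuous R)).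
have mf : measurable_fun setT (fun t => fl (Num.sqrt t)).
  exact: (measurableT_comp measurable_fl ms).
apply: measurable_funM.
  have mB : measurable_fun setT (fun t : R => Num.sqrt t - fl (Num.sqrt t)).
    exact: measurable_funB.
  apply: measurable_minr => //; apply: measurable_funB => //.
apply: (measurableT_comp mH); apply: measurable_funB => //.
by apply: measurable_funX; apply: measurable_funD.
Qed.

Lemma norm_glide H B t : (forall x, `|H x| <= B) -> `|glide H t| <= B.
Proof.
move=> HB; apply: le_trans (norm_tent_mul _ _ HB) _.
by have : 0 <= B; [exact: le_trans (HB 0)|lra].
Qed.

Let sqrt_gap (x u : R) : 0 < x -> 0 <= u ->
  Num.sqrt x <= Num.sqrt (u + x) /\ Num.sqrt (u + x) - Num.sqrt x <= u / Num.sqrt x.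
Proof.
move=> x0 u0; have s0 : 0 < Num.sqrt x by rewrite sqrtr_gt0.
have le : Num.sqrt x <= Num.sqrt (u + x) by rewrite ler_wsqrtr// lerDr.
split => //; rewrite ler_pdivlMr//.
have e1 : Num.sqrt x ^+ 2 = x by rewrite sqr_sqrtr// ltW.
have e2 : Num.sqrt (u + x) ^+ 2 = u + x by rewrite sqr_sqrtr// addr_ge0// ltW.
move: s0 le e1 e2; set a := Num.sqrt x; set b := Num.sqrt (u + x) => s0 le e1 e2.
have : (b - a) * (b + a) = u by rewrite -subr_sqr e1 e2; lra.
have : 0 <= (b - a) * b by rewrite mulr_ge0//; lra.
by rewrite mulrDr; lra.
Qed.

(** With factor and center frozen at [x], the integral is a multiple of one that vanishes by [orth].
    The remainder is bounded at each [t] by a constant times [t / sqrt x], and dominated convergence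
    concludes. With (p1, p2) the real and imaginary parts of [phi] this is the real part of the
    claim; with (p2, - p1) it is the imaginary part. *)
Lemma glide_cvg0 H1 H2 p1 p2 B : measurable_fun setT H1 -> measurable_fun setT H2 ->
  (forall x, `|H1 x| <= B) -> (forall x, `|H2 x| <= B) ->
  rL1 p1 -> rL1 p2 -> (forall t, t < 0 -> p1 t = 0 /\ p2 t = 0) ->
  (forall x, \int[mu]_t (H1 (t + x) * p1 t - H2 (t + x) * p2 t) = 0) ->
  \int[mu]_t (glide H1 (t + x) * p1 t - glide H2 (t + x) * p2 t)
    @[x --> +oo] --> (0 : R).
Proof.
move=> mH1 mH2 HB1 HB2 l1 l2 p0 orth; apply/cvg_pinftyP => u uoo.
have B0 : 0 <= B by exact: le_trans (HB1 0).
pose f n t := (glide H1 (t + u n) * p1 t - glide H2 (t + u n) * p2 t) -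
  tent (Num.sqrt (u n)) * (H1 (t + (u n - center (Num.sqrt (u n)))) * p1 t -
    H2 (t + (u n - center (Num.sqrt (u n)))) * p2 t).
have lH H p s : measurable_fun setT H -> (forall x, `|H x| <= B) -> rL1 p ->
    rL1 (fun t => H (t + s) * p t).
  move=> mH HB lp; apply: (rL1Ml (M := B) _ _ lp) => //.
  exact: (measurableT_comp mH (measurable_shift s)).
have lg H p s : measurable_fun setT H -> (forall x, `|H x| <= B) -> rL1 p ->
    rL1 (fun t => glide H (t + s) * p t).
  move=> mH HB lp; apply: (rL1Ml (M := B) _ _ lp) => //.
    exact: (measurableT_comp (measurable_glide mH) (measurable_shift s)).
  by move=> t; exact: norm_glide.
have lf n : rL1 (f n).
  apply: rL1B; first by apply: rL1B; exact: lg.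
  by apply/rL1Z/rL1B; exact: lH.
have -> : (fun n => \int[mu]_t (glide H1 (t + u n) * p1 t - glide H2 (t + u n) * p2 t)) =
    fun n => \int[mu]_t f n t.
  apply/funext => n; rewrite [RHS]RintegralB//; last 2 first.
  - by apply: rL1B; exact: lg.
  - by apply/rL1Z/rL1B; exact: lH.
  by rewrite RintegralZl//; [rewrite orth mulr0 subr0|apply: rL1B; exact: lH].
have fE n t : f n t = (tent (Num.sqrt (t + u n)) * H1 (t + u n - center (Num.sqrt (t + u n))) -
      tent (Num.sqrt (u n)) * H1 (t + u n - center (Num.sqrt (u n)))) * p1 t -
    (tent (Num.sqrt (t + u n)) * H2 (t + u n - center (Num.sqrt (t + u n))) -
      tent (Num.sqrt (u n)) * H2 (t + u n - center (Num.sqrt (u n)))) * p2 t.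
  by rewrite /f /glide !(addrA t); ring.
have -> : (0 : R) = \int[mu]_x (cst 0 x) by rewrite Rintegral_cst// mul0r.
apply: (@Rintegral_dominated_cvg _ _ (cst 0) (fun t => B * (`|p1 t| + `|p2 t|))).
- by move=> n; exact: rL1_measurable.
- by apply/rL1Z/rL1D; exact: rL1_norm.
- move=> n t; rewrite fE; apply: le_trans (ler_normB _ _) _.
  have hb H y z s : (forall x, `|H x| <= B) ->
      `|tent y * H z - tent s * H (t + u n - center s)| <= B.
    move=> HB; apply: le_trans (ler_normB _ _) _.
    have := norm_tent_mul z y HB; have := norm_tent_mul (t + u n - center s) s HB.
    by lra.
  rewrite !normrM mulrDr; apply: lerD; apply: ler_wpM2r => //; exact: hb.
move=> t /=; have [t0|t0] := ltP t 0.
  have [p10 p20] := p0 t t0.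
  have -> : f ^~ t = fun=> 0.
    by apply/funext => n; rewrite fE p10 p20 !mulr0 subr0.
  exact: cvg_cst.
pose K := 2 * B * t * (`|p1 t| + `|p2 t|).
have K0 : 0 <= K by rewrite /K !mulr_ge0// addr_ge0.
apply/cvgrPdist_lt => e e0.
(* The bound 1 makes [u n] positive; the bound [(K / e) ^+ 2] gives [K / sqrt (u n) < e]. *)
have [N _ hN] := (cvgryPgt _).1 uoo (Num.max 1 ((K / e) ^+ 2)).
exists N => // n /hN /=; rewrite gt_max => /andP[u1 uK].
have un0 : 0 < u n by lra.
have s0 : 0 < Num.sqrt (u n) by rewrite sqrtr_gt0.
have [le gap] := sqrt_gap un0 t0.
have bound H : (forall x, `|H x| <= B) ->
    `|tent (Num.sqrt (t + u n)) * H (t + u n - center (Num.sqrt (t + u n))) -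
      tent (Num.sqrt (u n)) * H (t + u n - center (Num.sqrt (u n)))| <=
    2 * B * (t / Num.sqrt (u n)).
  move=> HB; apply: le_trans (tent_modulation _ HB le) _.
  by rewrite ler_wpM2l// mulr_ge0.
rewrite sub0r normrN fE.
apply: (@le_lt_trans _ _ (K / Num.sqrt (u n))).
  apply: le_trans (ler_normB _ _) _; rewrite !normrM.
  have h1 := ler_wpM2r (normr_ge0 (p1 t)) (bound _ HB1).
  have h2 := ler_wpM2r (normr_ge0 (p2 t)) (bound _ HB2).
  apply: le_trans (lerD h1 h2) _; rewrite -mulrDr /K.
  by rewrite le_eqVlt; apply/orP; left; apply/eqP; ring.
rewrite ltr_pdivrMr// mulrC -ltr_pdivrMr//.
rewrite -(@ger0_norm _ (K / e)) ?divr_ge0// ?ltW// -sqrtr_sqr ltr_sqrt//.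
Qed.

(** Seen from the points [(n + 1/2)^2 + x0], [glide H] is [H] near [x0] times a factor of at least
    1/4. There [H] keeps its sign and at least half of [|H x0|], so integrals over (0, r] stay away
    from 0. *)
Lemma glide_ncvg0 H B x0 : continuous H -> (forall x, `|H x| <= B) -> H x0 != 0 ->
  exists2 r, 0 <= r & ~ (\int[mu]_t (glide H (t + s) * oc 0 r t) @[s --> +oo] --> (0 : R)).
Proof.
move=> cH HB H0; pose eta := `|H x0|; have eta0 : 0 < eta by rewrite normr_gt0.
have mH := continuous_measurable_fun cH.
have eta2 : 0 < eta / 2 by rewrite divr_gt0.
have /cvgrPdist_le/(_ (eta / 2) eta2)/nbhs_ballP[r /= r0 hr] := cH x0.
exists (r / 2); first by rewrite divr_ge0// ltW.
move=> /cvg_pinftyP cvg0.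
pose s (n : nat) : R := (n%:R + 2^-1) ^+ 2 + x0.
have s_ge n : n%:R + x0 <= s n.
  rewrite /s lerD2r sqrrD; have : 0 <= (n%:R : R) by [].
  have : 0 <= (n%:R : R) ^+ 2 by rewrite sqr_ge0.
  have : (2^-1 : R) ^+ 2 = 4^-1 by field.
  by move=> ->; lra.
have soo : s n @[n --> \oo] --> +oo.
  apply/cvgryPge => A; near=> n; apply: le_trans (s_ge n).
  have : A - x0 <= n%:R by near: n; exact: nbhs_infty_ger.
  by lra.
pose sg := Num.sg (H x0).
have sgN : `|sg| = 1 by rewrite normr_sg H0.
have near_val y : `|y - x0| < r -> eta / 2 <= sg * H y.
  move=> yx; have : `|H x0 - H y| <= eta / 2 by apply: hr; rewrite /ball/= distrC.
  rewrite ler_norml => /andP[h1 h2]; have [hx|hx] := ltP (H x0) 0.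
    have -> : sg = -1 by exact: ltr0_sg.
    by move: h1 h2; rewrite /eta (ltr0_norm hx); lra.
  have hx' : 0 < H x0 by rewrite lt_neqAle eq_sym H0.
  have -> : sg = 1 by exact: gtr0_sg.
  by move: h1 h2; rewrite /eta (gtr0_norm hx'); lra.
have main n t : `|x0| + r <= n%:R / 2 -> 0 < t <= r / 2 ->
    eta / 8 <= sg * glide H (t + s n).
  move=> hn /andP[t0 tr].
  have n0 : 0 <= (n%:R : R) by [].
  have := lexx `|x0|; rewrite {1}ler_norml => /andP[x1 x2].
  (* The squares of [n + 1/4] and [n + 3/4] are at distance about [n / 2] from that of [n + 1/2].
     Hence a displacement of at most [|x0| + r <= n / 2] leaves the root in the middle half of its
     cell, where [tent] is at least 1/4. *)
  have lo : n%:R + 4^-1 <= Num.sqrt (t + s n).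
    rewrite -[leLHS]ger0_norm; last by lra.
    rewrite -sqrtr_sqr ler_wsqrtr// /s !sqrrD.
    have -> : (2^-1 : R) ^+ 2 = 4^-1 by field.
    have -> : (4^-1 : R) ^+ 2 = 16^-1 by field.
    by lra.
  have hi : Num.sqrt (t + s n) <= n%:R + 3 / 4.
    rewrite -[leRHS]ger0_norm; last by lra.
    rewrite -sqrtr_sqr ler_wsqrtr// /s !sqrrD.
    have -> : (2^-1 : R) ^+ 2 = 4^-1 by field.
    have -> : (3 / 4 : R) ^+ 2 = 9 / 16 by field.
    by lra.
  have fn : fl (Num.sqrt (t + s n)) = n%:R.
    rewrite /fl (@floor_def _ _ n%:Z)//.
    by rewrite intrD /= -!pmulrn; apply/andP; split; lra.
  rewrite /glide /center /tent fn mulrCA.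
  have -> : t + s n - (n%:R + 2^-1) ^+ 2 = t + x0 by rewrite /s; lra.
  have hv : eta / 2 <= sg * H (t + x0).
    by apply: near_val; rewrite addrK ger0_norm; lra.
  have ht : 4^-1 <= Num.min (Num.sqrt (t + s n) - n%:R) (1 - (Num.sqrt (t + s n) - n%:R)).
    by rewrite le_min; apply/andP; split; lra.
  have -> : eta / 8 = 4^-1 * (eta / 2) by field.
  by apply: ler_pM => //; rewrite divr_ge0// ltW.
have lint n : rL1 (fun t => glide H (t + s n) * oc 0 (r / 2) t).
  apply: (rL1Ml (M := B) _ _ (rL1_oc _ _)).
    exact: (measurableT_comp (measurable_glide mH) (measurable_shift _)).
  by move=> t; exact: norm_glide.
have r2 : 0 <= r / 2 by rewrite divr_ge0// ltW.
have int_ge n : `|x0| + r <= n%:R / 2 ->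
    eta / 8 * (r / 2) <= `|\int[mu]_t (glide H (t + s n) * oc 0 (r / 2) t)|.
  move=> hn; apply: (@le_trans _ _
      (sg * \int[mu]_t (glide H (t + s n) * oc 0 (r / 2) t))); last first.
    by apply: le_trans (ler_norm _) _; rewrite normrM sgN mul1r.
  have -> : eta / 8 * (r / 2) = \int[mu]_t (eta / 8 * oc 0 (r / 2) t).
    by rewrite RintegralZl ?Rintegral_oc ?subr0//; exact: rL1_oc.
  rewrite -(RintegralZl sg measurableT (lint n)).
  apply: le_Rintegral => //; [exact/rL1Z/rL1_oc|exact: rL1Z|].
  move=> t _; have [[-> ht]|[-> _]] := oc_cases 0 (r / 2) t; last by rewrite !mulr0.
  by rewrite !mulr1; exact: main.
have e0 : 0 < eta / 8 * (r / 2) by rewrite mulr_gt0// divr_gt0.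
have [N _ hN] := (cvgrPdist_lt _ _).1 (cvg0 _ soo) _ e0.
have [N' _ hN'] := (cvgryPge _).1 (@cvgr_idn R) (2 * (`|x0| + r)).
have /= := hN (maxn N N') (leq_maxl _ _); rewrite sub0r normrN ltNge => /negP; apply.
apply: int_ge; have /= := hN' (maxn N N') (leq_maxr _ _); lra.
Unshelve. all: by end_near. Qed.

End gliding_hump.

(** * The Hahn-Banach theorem *)

Section hahn_banach.
Context {R : realType} {V : lmodType R} (D : set V).
Hypothesis DD : forall x y, D x -> D y -> D (x + y).
Hypothesis DZ : forall (c : R) x, D x -> D (c *: x).

(** Conditions are imposed on the subspace [D] alone: [V] will hold all pairs of functions and [D]
    the integrable ones. Homogeneity is an inequality, the form in which infima are easily checked;
    [sublinearZ] recovers equality. *)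
Definition sublinear (q : V -> R) :=
  (forall x y, D x -> D y -> q (x + y) <= q x + q y) /\
  (forall c x, 0 <= c -> D x -> q (c *: x) <= c * q x).

Let D0 x : D x -> D 0.
Proof. by move=> /(DZ 0); rewrite scale0r. Qed.

Let DN x : D x -> D (- x).
Proof. by move=> /(DZ (-1)); rewrite scaleN1r. Qed.

Lemma sublinear0 q x : sublinear q -> D x -> q 0 = 0.
Proof.
move=> [qD qZ] Dx; apply/le_anti/andP; split.
  by have := qZ 0 x (lexx _) Dx; rewrite scale0r mul0r.
by have := qD _ _ (D0 Dx) (D0 Dx); rewrite addr0; lra.
Qed.

Lemma sublinearN q x : sublinear q -> D x -> - q (- x) <= q x.
Proof.
move=> sq Dx; have := sq.1 _ _ Dx (DN Dx); rewrite subrr.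
by rewrite (sublinear0 sq Dx); lra.
Qed.

Lemma sublinearZ q c x : sublinear q -> 0 <= c -> D x -> q (c *: x) = c * q x.
Proof.
move=> sq; rewrite le_eqVlt => /predU1P[<- Dx|c0 Dx].
  by rewrite scale0r mul0r (sublinear0 sq Dx).
apply/le_anti/andP; split; first by apply: sq.2 => //; exact: ltW.
have := sq.2 c^-1 (c *: x); rewrite invr_ge0 ltW// => /(_ isT (DZ _ Dx)).
by rewrite scalerA mulVf ?gt_eqF// scale1r ler_pdivlMl.
Qed.

(** The infimum over these values is the sublinear functional below [q] whose value at [- y] is at
    most [- q y]. *)
Let slides (q : V -> R) y x : set R :=
  [set r | exists2 t, 0 <= t & r = q (x + t *: y) - t * q y].

Let slide q y x := inf (slides q y x).

Let slides_lb q y x : sublinear q -> D x -> D y ->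
  lbound (slides q y x) (- q (- x)).
Proof.
move=> sq Dx Dy _ [t t0 ->]; rewrite -(sublinearZ sq t0 Dy).
have := sq.1 _ _ (DD Dx (DZ t Dy)) (DN Dx).
by rewrite addrAC subrr add0r; lra.
Qed.

Let slide_le q y x t : sublinear q -> D x -> D y -> 0 <= t ->
  slide q y x <= q (x + t *: y) - t * q y.
Proof.
move=> sq Dx Dy t0; apply: ge_inf; last by exists t.
by exists (- q (- x)); exact: slides_lb.
Qed.

Let le_slide q y x r :
  (forall t, 0 <= t -> r <= q (x + t *: y) - t * q y) -> r <= slide q y x.
Proof.
move=> h; apply: lb_le_inf; first by exists (q (x + 0 *: y) - 0 * q y), 0.
by move=> _ [t t0 ->]; exact: h.
Qed.

Let slide_sublinear q y : sublinear q -> D y -> sublinear (slide q y).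
Proof.
move=> sq Dy; split=> [x z Dx Dz|c x c0 Dx].
  rewrite -lerBlDr; apply: le_slide => t t0.
  rewrite lerBlDr -lerBlDl; apply: le_slide => s s0; rewrite lerBlDl.
  apply: le_trans (slide_le sq (DD Dx Dz) Dy (addr_ge0 t0 s0)) _.
  have := sq.1 _ _ (DD Dx (DZ t Dy)) (DD Dz (DZ s Dy)).
  by rewrite addrACA -scalerDl mulrDl; lra.
have [->|cn0] := eqVneq c 0.
  rewrite scale0r mul0r; apply: le_trans (slide_le sq (D0 Dx) Dy (lexx 0)) _.
  by rewrite scale0r addr0 mul0r subr0 (sublinear0 sq Dx).
have cp : 0 < c by rewrite lt_neqAle eq_sym cn0.
rewrite -ler_pdivrMl//; apply: le_slide => t t0; rewrite ler_pdivrMl//.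
apply: le_trans (slide_le sq (DZ c Dx) Dy (mulr_ge0 c0 t0)) _.
rewrite -scalerA -scalerDr (sublinearZ sq c0); last exact: DD (DZ _ _).
by rewrite mulrBr mulrA.
Qed.

Let slide_leq q y x : sublinear q -> D x -> D y -> slide q y x <= q x.
Proof.
move=> sq Dx Dy; have := slide_le sq Dx Dy (lexx 0).
by rewrite scale0r addr0 mul0r subr0.
Qed.

Let below p := {q : V -> R | sublinear q /\ forall x, D x -> q x <= p x}.

(** Smaller functionals come later, so that a maximal element in Zorn's lemma is a minimal
    functional. It is only a preorder, since values outside [D] are ignored. *)
Let lower p (q r : below p) := `[< forall x, D x -> sval r x <= sval q x >].

Let chain_inf p (A : set (below p)) : sublinear p -> total_on A (@lower p) ->
  exists t, forall s, A s -> lower s t.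
Proof.
move=> sp totA.
have [[q0 Aq0]|A0] := pselect (exists q, A q); last first.
  exists (exist _ p (conj sp (fun x _ => lexx (p x)))) => s As.
  by exfalso; apply: A0; exists s.
pose B x := [set sval q x | q in A].
have lbB x : D x -> lbound (B x) (- p (- x)).
  move=> Dx _ [[q [sq qp]] _ <-] /=.
  by apply: le_trans (sublinearN sq Dx); rewrite lerN2; exact/qp/DN.
have infle x q : D x -> A q -> inf (B x) <= sval q x.
  move=> Dx Aq; apply: ge_inf; last by exists q.
  by exists (- p (- x)); exact: lbB.
have leinf x r : (forall q, A q -> r <= sval q x) -> r <= inf (B x).
  move=> h; apply: lb_le_inf; first by exists (sval q0 x), q0.
  by move=> _ [q Aq <-]; exact: h.
have sinf : sublinear (fun x => inf (B x)).
  split=> [x y Dx Dy|c x c0 Dx].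
    rewrite -lerBlDr; apply: (leinf x) => q Aq; rewrite lerBlDr -lerBlDl.
    apply: (leinf y) => r Ar; rewrite lerBlDl.
    (* A pointwise infimum of sublinear functionals need not be subadditive; in a chain, the smaller
       of [q] and [r] bounds the value at [x + y]. *)
    have [/asboolP h|/asboolP h] := totA _ _ Aq Ar.
      apply: le_trans (infle _ _ (DD Dx Dy) Ar) _.
      apply: le_trans ((svalP r).1.1 _ _ Dx Dy) _.
      by rewrite lerD2r; exact: h.
    apply: le_trans (infle _ _ (DD Dx Dy) Aq) _.
    apply: le_trans ((svalP q).1.1 _ _ Dx Dy) _.
    by rewrite lerD2l; exact: h.
  have [->|cn0] := eqVneq c 0.
    rewrite scale0r mul0r; apply: le_trans (infle _ _ (D0 Dx) Aq0) _.
    by rewrite (sublinear0 (svalP q0).1 Dx).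
  have cp : 0 < c by rewrite lt_neqAle eq_sym cn0.
  rewrite -ler_pdivrMl//; apply: (leinf x) => q Aq; rewrite ler_pdivrMl//.
  apply: le_trans (infle _ _ (DZ c Dx) Aq) _.
  exact: (svalP q).1.2.
have infp x : D x -> inf (B x) <= p x.
  by move=> Dx; apply: le_trans (infle _ _ Dx Aq0) _; exact: (svalP q0).2.
pose t : below p := exist _ (fun x => inf (B x)) (conj sinf infp).
exists t => q Aq; apply/asboolP => x Dx /=.
exact: infle.
Qed.

(* A minimal sublinear functional is linear, because sliding it along any y
   gives a smaller sublinear functional; sliding p along v beforehand forces
   the value at v. *)
Lemma hahn_banach p v : sublinear p -> D v ->
  exists L : V -> R, [/\ forall x y, D x -> D y -> L (x + y) = L x + L y,
    forall c x, D x -> L (c *: x) = c * L x,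
    forall x, D x -> L x <= p x & L v = p v].
Proof.
move=> sp Dv; pose p' := slide p v.
have sp' : sublinear p' by exact: slide_sublinear.
have p'p x : D x -> p' x <= p x by move=> Dx; exact: slide_leq.
have refl t : @lower p' t t by apply/asboolP => x Dx.
have trans r s t : @lower p' r s -> lower s t -> lower r t.
  move=> /asboolP rs /asboolP st; apply/asboolP => x Dx.
  exact: le_trans (st _ Dx) (rs _ Dx).
have [[q [sq qp']] qmin] := @ZL_preorder (below p')
  (exist _ p' (conj sp' (fun x _ => lexx (p' x)))) (@lower p') refl trans
  (fun A totA => chain_inf sp' totA).
have qD x y : D x -> D y -> q (x + y) = q x + q y.
  move=> Dx Dy; apply/le_anti; rewrite sq.1//=.
  have sl z : D z -> slide q y z <= p' z.
    by move=> Dz; apply: le_trans (qp' _ Dz); exact: slide_leq.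
  pose r : below p' := exist _ _ (conj (slide_sublinear sq Dy) sl).
  have /qmin/asboolP/(_ _ Dx) h : lower (exist _ q (conj sq qp')) r.
    by apply/asboolP => z Dz /=; exact: slide_leq.
  have := le_trans h (slide_le sq Dx Dy ler01).
  by rewrite scale1r mul1r /=; lra.
have qN x : D x -> q (- x) = - q x.
  move=> Dx; have := qD _ _ Dx (DN Dx).
  by rewrite subrr (sublinear0 sq Dx); lra.
have qp x : D x -> q x <= p x.
  by move=> Dx; apply: le_trans (qp' _ Dx) (p'p _ Dx).
exists q; split => //.
  move=> c x Dx; have [c0|/ltW c0] := leP 0 c; first exact: sublinearZ.
  rewrite -[c]opprK scaleNr qN; last exact: DZ.
  by rewrite (sublinearZ sq) ?oppr_ge0// !mulNr.
apply/le_anti; rewrite qp//=.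
(* At [- v] the slid functional is at most [p 0 - p v = - p v], which forces [q v >= p v]. *)
have := qp' _ (DN Dv); rewrite qN//.
have := slide_le sp (DN Dv) Dv ler01.
by rewrite scale1r mul1r addNr (sublinear0 sp Dv) -/(p' (- v)); lra.
Qed.

Section separation.
Variables (N : V -> R) (W : set V).
Hypothesis ND : forall x y, D x -> D y -> N (x + y) <= N x + N y.
Hypothesis NZ : forall c x, D x -> N (c *: x) = `|c| * N x.
Hypothesis N0 : forall x, 0 <= N x.
Hypothesis WD : forall x, W x -> D x.
Hypothesis W0 : W 0.
Hypothesis WDD : forall x y, W x -> W y -> W (x + y).
Hypothesis WZ : forall c x, W x -> W (c *: x).

Let dist x := inf [set N (x - w) | w in W].

Let dist_le x w : W w -> dist x <= N (x - w).
Proof. by move=> Ww; apply: ge_inf; [exists 0 => _ [? _ <-]|exists w]. Qed.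

Let le_dist x r : (forall w, W w -> r <= N (x - w)) -> r <= dist x.
Proof.
move=> h; apply: lb_le_inf; first by exists (N (x - 0)), 0.
by move=> _ [w Ww <-]; exact: h.
Qed.

Let DB x y : D x -> D y -> D (x - y).
Proof. by move=> Dx Dy; apply: DD => //; exact: DN. Qed.

Let sublinear_dist : sublinear dist.
Proof.
split=> [x y Dx Dy|c x c0 Dx].
  rewrite -lerBlDr; apply: (le_dist) => w Ww.
  rewrite lerBlDr -lerBlDl; apply: (le_dist) => z Wz; rewrite lerBlDl.
  apply: le_trans (dist_le _ (WDD Ww Wz)) _; rewrite opprD addrACA.
  by apply: ND; apply: DB => //; exact: WD.
have [->|cn0] := eqVneq c 0.
  rewrite scale0r mul0r; apply: le_trans (dist_le _ W0) _.
  by rewrite -(scale0r x) -scalerBr NZ ?normr0 ?mul0r//; exact: DB.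
have cp : 0 < c by rewrite lt_neqAle eq_sym cn0.
rewrite -ler_pdivrMl//; apply: (le_dist) => w Ww; rewrite ler_pdivrMl//.
apply: le_trans (dist_le _ (WZ c Ww)) _.
by rewrite -scalerBr NZ ?ger0_norm//; apply: DB => //; exact: WD.
Qed.

(** The distance to [W] serves as sublinear functional: it is at most [N], at most 0 on [W], and at
    least [e] at [v], where the linear functional attains it. *)
Lemma hahn_banach_separation v e : D v -> 0 < e ->
  (forall w, W w -> e <= N (v - w)) ->
  exists L : V -> R, [/\ forall x y, D x -> D y -> L (x + y) = L x + L y,
    forall c x, D x -> L (c *: x) = c * L x,
    forall x, D x -> `|L x| <= N x, forall w, W w -> L w = 0 & L v != 0].
Proof.
move=> Dv e0 vW; have [L [LD LZ Lp Lv]] := hahn_banach sublinear_dist Dv.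
have LN x : D x -> L (- x) = - L x by move=> Dx; rewrite -scaleN1r LZ// mulN1r.
have distN x : dist x <= N x by have := dist_le x W0; rewrite subr0.
have NN x : D x -> N (- x) = N x by move=> Dx; rewrite -scaleN1r NZ// normrN1 mul1r.
have distW w : W w -> dist w <= 0.
  move=> Ww; apply: le_trans (dist_le _ Ww) _.
  by rewrite subrr -(scale0r w) NZ ?normr0 ?mul0r//; exact: WD.
exists L; split => //.
- move=> x Dx; rewrite ler_norml lerNl -LN//; apply/andP; split.
    by rewrite -NN//; apply: le_trans (Lp _ (DN Dx)) (distN _).
  exact: le_trans (Lp _ Dx) (distN _).
- move=> w Ww; have Dw := WD Ww; apply/le_anti/andP; split.
    exact: le_trans (Lp _ Dw) (distW _ Ww).
  rewrite -oppr_le0 -LN//; apply: le_trans (Lp _ (DN Dw)) _.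
  by apply: distW; rewrite -scaleN1r; exact: WZ.
by rewrite Lv gt_eqF// (lt_le_trans e0)//; exact: le_dist.
Qed.

End separation.

End hahn_banach.

(** * The equivalence *)

Section annihilator.
Context {R : realType}.
Local Notation mu := (@lebesgue_measure R).
Local Notation C := R[i].

Let V : lmodType R := ((R -> R^o) * (R -> R^o))%type.

Let toC (v : V) : R -> C := fun x => Complex (v.1 x) (v.2 x).

Let D : set V := [set v | rL1 v.1 /\ rL1 v.2].

Let N (v : V) := L1norm v.1 + L1norm v.2.

(** The ideal enters as a closed real subspace of pairs; a functional on pairs splits as
    [L (f, 0) + L (0, g)]. *)
Lemma closed_ideal_separation (I : set (R -> C)) (g0 : R -> C) :
  closed_ideal I -> L1 g0 -> ~ I g0 ->
  exists Lre Lim : (R -> R) -> R,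
  [/\ (forall f g, rL1 f -> rL1 g -> Lre (fun x => f x + g x) = Lre f + Lre g) /\
      (forall f g, rL1 f -> rL1 g -> Lim (fun x => f x + g x) = Lim f + Lim g),
      (forall c f, rL1 f -> Lre (fun x => c * f x) = c * Lre f) /\
      (forall c f, rL1 f -> Lim (fun x => c * f x) = c * Lim f),
      (forall f, rL1 f -> `|Lre f| <= L1norm f) /\
      (forall f, rL1 f -> `|Lim f| <= L1norm f),
      (forall g, I g -> Lre (cRe \o g) + Lim (cIm \o g) = 0) &
      Lre (cRe \o g0) + Lim (cIm \o g0) != 0].
Proof.
move=> [IL1 I0 ID IZ [_ Icl]] [g01 g02] Ig0.
have [e e0 he] : exists2 e : R, 0 < e &
    forall g, I g -> (e%:E <= \int[mu]_x (cabs (g0 x - g x))%:E)%E.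
  (* At distance 0 from the ideal, [g0] would belong to it by closedness. *)
  apply: contrapT => h; apply: Ig0; apply: Icl => // e e0.
  apply: contrapT => h'; apply: h; exists e => // g Ig.
  by rewrite leNgt; apply/negP => lt; apply: h'; exists g.
have DD x y : D x -> D y -> D (x + y).
  by move=> [x1 x2] [y1 y2]; split; exact: rL1D.
have DZ (c : R) x : D x -> D (c *: x).
  by move=> [x1 x2]; split; exact: rL1Z.
pose W : set V := [set v | I (toC v)].
have toCK v : cRe \o toC v = v.1 /\ cIm \o toC v = v.2 by [].
have ND x y : D x -> D y -> N (x + y) <= N x + N y.
  move=> [x1 x2] [y1 y2]; rewrite /N addrACA.
  by apply: lerD; exact: L1normD.
have NZ c x : D x -> N (c *: x) = `|c| * N x.
  by move=> [x1 x2]; rewrite /N mulrDr; congr (_ + _); exact: L1normZ.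
have N0 x : 0 <= N x by rewrite addr_ge0 ?L1norm_ge0.
have WD x : W x -> D x by move=> /IL1.
have W0 : W 0 by [].
have WDD x y : W x -> W y -> W (x + y).
  by move=> Wx Wy; exact: ID Wx Wy.
have WZ (c : R) x : W x -> W (c *: x).
  move=> /(IZ (Complex c 0)); rewrite /W/=; congr I; apply/funext => t.
  by apply: complexP; rewrite ?cReM ?cImM /= ?mul0r ?subr0 ?addr0.
pose v0 : V := (cRe \o g0, cIm \o g0).
have Dv0 : D v0 by [].
have sep w : W w -> e <= N (v0 - w).
  move=> Ww; have lw := IL1 _ Ww.
  have [_ [_ h]] := L1norm_cRe (L1B (conj g01 g02 : L1 g0) lw).
  have := le_trans (he _ Ww) h; rewrite lee_fin; congr (_ <= _).
  rewrite /N; congr (L1norm _ + L1norm _); apply/funext => x /=.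
    by rewrite cReB.
  by rewrite cImB.
have [L [LD LZ LN LW Lv0]] :=
  hahn_banach_separation DD DZ ND NZ N0 WD W0 WDD WZ Dv0 e0 sep.
have D1 f : rL1 f -> D (f, 0) by split => //; exact: rL1_0.
have D2 f : rL1 f -> D (0, f) by split => //; exact: rL1_0.
have norm0 : L1norm (0 : R -> R) = 0.
  by have := L1normZ 0 (@rL1_0 R); under eq_fun do rewrite mul0r; rewrite normr0 mul0r.
have Lpair f g : rL1 f -> rL1 g -> L (f, g) = L (f, 0) + L (0, g).
  move=> lf lg; rewrite -(LD _ _ (D1 _ lf) (D2 _ lg)); congr L.
  by congr pair; rewrite ?addr0 ?add0r.
exists (fun f => L (f, 0)), (fun f => L (0, f)); split.
- split=> f g lf lg.
    rewrite -(LD _ _ (D1 _ lf) (D1 _ lg)); congr L.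
    by congr pair; rewrite addr0.
  rewrite -(LD _ _ (D2 _ lf) (D2 _ lg)); congr L.
  by congr pair; rewrite addr0.
- split=> c f lf.
    by rewrite -(LZ _ _ (D1 _ lf)); congr L; congr pair; rewrite scaler0.
  by rewrite -(LZ _ _ (D2 _ lf)); congr L; congr pair; rewrite scaler0.
- split=> f lf.
    by apply: le_trans (LN _ (D1 _ lf)) _; rewrite /N/= norm0 addr0.
  by apply: le_trans (LN _ (D2 _ lf)) _; rewrite /N/= norm0 add0r.
- move=> g Ig; have [lg1 lg2] := IL1 _ Ig; rewrite -Lpair//; apply: LW.
  rewrite /W/=; have -> // : toC (cRe \o g, cIm \o g) = g.
  by apply/funext => x; exact: complexP.
by rewrite -Lpair.
Qed.

(** The ideal is known to contain some function almost everywhere equal to the convolution;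
    closedness, at distance 0, passes to this representative. *)
Lemma closed_ideal_L1conv (I : set (R -> C)) f h : closed_ideal I -> I f -> L1 h ->
  I (L1conv h f).
Proof.
move=> [IL1 _ _ _ [Imul Icl]] If lh; have lf := IL1 _ If.
have [k Ik hk] := Imul _ _ If lh; have lk := IL1 _ Ik.
have lc := L1_L1conv lh lf.
apply: Icl => // e e0; exists k => //.
have lB := L1B lc lk; have [_ [_ hN]] := L1norm_cRe lB.
apply: le_lt_trans hN _; rewrite lte_fin.
have ae : {ae mu, forall x, L1conv h f x - k x = 0}.
  apply: ae_imply (ae_conj (ae_L1conv lh lf) hk) _ => x [-> ->].
  exact: subrr.
rewrite !L1norm_ae0 ?addr0//; [exact: rL1_measurable lB.2| |exact: rL1_measurable lB.1|].
  by apply: ae_imply ae _ => x /= ->.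
by apply: ae_imply ae _ => x /= ->.
Qed.

End annihilator.

(** * The two summability methods as convolutions *)

Section summability.
Context {R : realType}.
Local Notation mu := (@lebesgue_measure R).
Local Notation C := R[i].
Implicit Types (f g phi : R -> C).

Local Notation tail s := (`[s, +oo[%classic : set R).

Lemma Linfty_representative f : Linfty_Rplus f ->
  exists (w : R -> C) (M : R), [/\
    measurable_fun setT (cRe \o w) /\ measurable_fun setT (cIm \o w),
    forall x, `|(cRe \o w) x| <= M, forall x, `|(cIm \o w) x| <= M &
    {ae mu, forall x, Rplus x -> f x = w x}].
Proof.
move=> [[m1 m2] [M fM]].
have [|w1 [mw1 wM1 e1]] := @bounded_representative R (cRe \o f) M m1.
  by apply: ae_imply fM _ => x fx Rx; exact: le_trans (norm_cRe_le _) (fx Rx).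
have [|w2 [mw2 wM2 e2]] := @bounded_representative R (cIm \o f) M m2.
  by apply: ae_imply fM _ => x fx Rx; exact: le_trans (norm_cIm_le _) (fx Rx).
exists (fun x => Complex (w1 x) (w2 x)), `|M|; split => //.
apply: ae_imply (ae_conj e1 e2) _ => x [h1 h2] Rx.
by apply: complexP; [exact: h1|exact: h2].
Qed.

Lemma measurable_tail_cproduct f g (s : R) : 0 <= s -> cmeasurable Rplus f ->
  cmeasurable Rplus g ->
  measurable_fun (tail s) (cRe \o (fun t => f t * g (t - s))) /\
  measurable_fun (tail s) (cIm \o (fun t => f t * g (t - s))).
Proof.
move=> s0 [f1 f2] [g1 g2].
have mt : measurable (tail s) by exact: measurable_itv.
have h u v mu_ mv := (measurable_restrictT _ mt).2 (@measurable_tail_product R s s0 u v mu_ mv).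
split.
  have := measurable_funB (h _ _ f1 g1) (h _ _ f2 g2).
  by congr measurable_fun; apply/funext => t; rewrite /= cReM.
have := measurable_funD (h _ _ f1 g2) (h _ _ f2 g1).
by congr measurable_fun; apply/funext => t; rewrite /= cImM.
Qed.

Lemma cint_tail_shift f g (s : R) : 0 <= s -> cmeasurable Rplus f ->
  cmeasurable Rplus g ->
  cint (tail s) (fun t => f t * g (t - s)) =
  cint Rplus (fun t => f (t + s) * g t).
Proof.
move=> s0 mf mg; have [m1 m2] := measurable_tail_cproduct s0 mf mg.
have mt : measurable (tail s) by exact: measurable_itv.
congr Complex.
  rewrite (@Rintegral_tail_shift R s (cRe \o _)); last exact/(measurable_restrictT _ mt).
  by apply: eq_Rintegral => t _ /=; rewrite addrK.
rewrite (@Rintegral_tail_shift R s (cIm \o _)); last exact/(measurable_restrictT _ mt).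
by apply: eq_Rintegral => t _ /=; rewrite addrK.
Qed.

Lemma cint_tail_L1conv f w (M : R) g (s : R) : 0 <= s ->
  cmeasurable Rplus f -> cintegrable Rplus g ->
  measurable_fun setT (cRe \o w) -> measurable_fun setT (cIm \o w) ->
  (forall x, `|(cRe \o w) x| <= M) -> (forall x, `|(cIm \o w) x| <= M) ->
  {ae mu, forall x, Rplus x -> f x = w x} ->
  cint (tail s) (fun t => f t * g (t - s)) = L1conv (phistar g) w s.
Proof.
move=> s0 mf [g1 g2] mw1 mw2 wM1 wM2 fw.
have mg : cmeasurable Rplus g.
  by split; apply/measurable_EFinP; [exact: measurable_int g1|exact: measurable_int g2].
have mw : cmeasurable Rplus w by split; exact: measurable_funTS.
have [f1 f2] := measurable_tail_cproduct s0 mf mg.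
have [w1 w2] := measurable_tail_cproduct s0 mw mg.
have mt : measurable (tail s) by exact: measurable_itv.
have fw' : {ae mu, forall x, tail s x -> f x * g (x - s) = w x * g (x - s)}.
  apply: ae_imply fw _ => x fx; rewrite /= in_itv/= andbT => sx; rewrite fx//.
  by rewrite /Rplus/= in_itv/= andbT (le_trans s0 sx).
transitivity (cint (tail s) (fun t => w t * g (t - s))).
  congr Complex; apply: ae_eq_Rintegral => //.
    by apply: ae_imply fw' _ => x h tx; rewrite /= h.
  by apply: ae_imply fw' _ => x h tx; rewrite /= h.
rewrite /L1conv cRe_phistar cIm_phistar.
have [i11 <-] := Rintegral_tail_rconv s mw1 wM1 g1.
have [i22 <-] := Rintegral_tail_rconv s mw2 wM2 g2.
have [i12 <-] := Rintegral_tail_rconv s mw2 wM2 g1.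
have [i21 <-] := Rintegral_tail_rconv s mw1 wM1 g2.
congr Complex.
  rewrite -RintegralB//; apply: eq_Rintegral => t _; exact: cReM.
rewrite -RintegralD//; apply: eq_Rintegral => t _ /=; rewrite cImM; exact: addrC.
Qed.

Lemma cintegrable_measurable g : cintegrable Rplus g -> cmeasurable Rplus g.
Proof.
by move=> [g1 g2]; split; apply/measurable_EFinP;
  [exact: measurable_int g1|exact: measurable_int g2].
Qed.

Lemma L1_phistar g : cintegrable Rplus g -> L1 (phistar g).
Proof.
move=> [g1 g2]; apply/L1P; rewrite cRe_phistar cIm_phistar.
by split; exact: rL1_rstar.
Qed.

Lemma cint_phistar g : cintegrable Rplus g ->
  cint setT (phistar g) = cint Rplus g.
Proof.
move=> [g1 g2]; congr Complex.
  by rewrite cRe_phistar Rintegral_rstar.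
by rewrite cIm_phistar Rintegral_rstar.
Qed.

(** [Sstar phi] is [Ksum] tested against [phi] alone, up to a shift of the integration variable. *)
Lemma Ksum_Sstar phi f a : cintegrable Rplus phi -> cint Rplus phi = 1 ->
  Ksum f a -> Sstar phi f a.
Proof.
move=> lphi phi1 [lf Kf]; split => //; have := Kf _ lphi; rewrite phi1 mulr1.
apply: ccvg_near => s s0.
by rewrite cint_tail_shift//; [exact: lf.1|exact: cintegrable_measurable].
Qed.

Lemma Sstar_unique phi f a b : Sstar phi f a -> Sstar phi f b -> a = b.
Proof. by move=> [_ ha] [_ hb]; exact: ccvg_unique ha hb. Qed.

Lemma Sstar_Ksum phi f a : cintegrable Rplus phi -> cint Rplus phi = 1 ->
  L1 `<=` closed_ideal_gen (phistar phi) -> Sstar phi f a -> Ksum f a.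
Proof.
move=> lphi phi1 gen [lf Sf]; split => // g lg.
have [w [M [[mw1 mw2] wM1 wM2 fw]]] := Linfty_representative lf.
have tailE h s : cintegrable Rplus h -> 0 <= s ->
    cint (tail s) (fun t => f t * h (t - s)) = L1conv (phistar h) w s.
  by move=> lh s0; exact: (cint_tail_L1conv s0 lf.1 lh mw1 mw2 wM1 wM2 fw).
have [] := gen _ (L1_phistar lg) _ (conj (closed_ideal_tauberian a mw1 mw2 wM1 wM2) _).
  split; first exact: L1_phistar.
  rewrite cint_phistar// phi1 mulr1; apply: ccvg_near Sf => s s0.
  exact: tailE.
move=> _; rewrite cint_phistar//; apply: ccvg_near => s s0.
by rewrite -tailE// cint_tail_shift//; [exact: lf.1|exact: cintegrable_measurable].
Qed.

End summability.

(** * A proper closed ideal separates the methods *)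

Section necessity.
Context {R : realType}.
Local Notation mu := (@lebesgue_measure R).
Local Notation C := R[i].
Variable phi : R -> C.
Hypothesis lphi : cintegrable Rplus phi.

Let p1 := (cRe \o phi) \_ Rplus.
Let p2 := (cIm \o phi) \_ Rplus.

Let lp1 : rL1 p1. Proof. exact: rL1_patch_Rplus lphi.1. Qed.
Let lp2 : rL1 p2. Proof. exact: rL1_patch_Rplus lphi.2. Qed.

Let p_neg t : t < 0 -> p1 t = 0 /\ p2 t = 0.
Proof. by move=> t0; rewrite /p1 /p2 !patch_RplusE leNgt t0. Qed.

(** The ideal contains the convolution of [phistar phi] with the indicator of (a, a + d], and also i
    times it. Exchanging the functionals with the integral turns their vanishing on these two
    elements into the two relations. *)
Lemma ideal_window_orthogonal (I : set (R -> C)) (Lre Lim : (R -> R) -> R) (d : R) :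
  closed_ideal I -> I (phistar phi) ->
  (forall g, I g -> Lre (cRe \o g) + Lim (cIm \o g) = 0) ->
  (forall f g, rL1 f -> rL1 g -> Lre (fun x => f x + g x) = Lre f + Lre g) ->
  (forall f g, rL1 f -> rL1 g -> Lim (fun x => f x + g x) = Lim f + Lim g) ->
  (forall c f, rL1 f -> Lre (fun x => c * f x) = c * Lre f) ->
  (forall c f, rL1 f -> Lim (fun x => c * f x) = c * Lim f) ->
  (forall f, rL1 f -> `|Lre f| <= L1norm f) ->
  (forall f, rL1 f -> `|Lim f| <= L1norm f) -> 0 <= d -> forall a,
  \int[mu]_t (window Lre d (a + t) * rstar (cRe \o phi) t) +
    \int[mu]_t (window Lim d (a + t) * rstar (cIm \o phi) t) = 0 /\
  \int[mu]_t (window Lim d (a + t) * rstar (cRe \o phi) t) -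
    \int[mu]_t (window Lre d (a + t) * rstar (cIm \o phi) t) = 0.
Proof.
move=> cI Iphi LI D1 D2 Z1 Z2 N1 N2 d0 a.
have l1 := rL1_rstar lphi.1; have l2 := rL1_rstar lphi.2.
rewrite -!(functional_rconv D1 Z1 N1 d0 a)// -!(functional_rconv D2 Z2 N2 d0 a)//.
set h := oc a (a + d).
pose hC : R -> C := fun x => Complex (h x) 0.
have lhC : L1 hC by split; [exact: rL1_oc|exact: rL1_0].
have Ik := closed_ideal_L1conv cI Iphi lhC.
have zero f : rconv (fun=> 0) f = fun=> 0 :> R.
  apply/funext => x; rewrite /rconv -[RHS](_ : \int[mu]_t (cst 0 t) = 0).
    by apply: eq_Rintegral => t _; rewrite mul0r.
  by rewrite Rintegral_cst// mul0r.
have r1 : cRe \o L1conv hC (phistar phi) = rconv h (rstar (cRe \o phi)).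
  apply/funext => x; transitivity (rconv h (cRe \o phistar phi) x -
    rconv (fun=> 0) (cIm \o phistar phi) x) => //.
  by rewrite zero subr0 cRe_phistar.
have r2 : cIm \o L1conv hC (phistar phi) = rconv h (rstar (cIm \o phi)).
  apply/funext => x; transitivity (rconv h (cIm \o phistar phi) x +
    rconv (fun=> 0) (cRe \o phistar phi) x) => //.
  by rewrite zero addr0 cIm_phistar.
split; first by have := LI _ Ik; rewrite r1 r2.
have [_ _ _ IZ _] := cI.
have := LI _ (IZ (Complex 0 1) _ Ik).
have -> : cRe \o (fun x => Complex 0 1 * L1conv hC (phistar phi) x) =
    fun x => -1 * rconv h (rstar (cIm \o phi)) x.
  rewrite -r2; apply/funext => x; pose z := L1conv hC (phistar phi) x.
  transitivity (0 * cRe z - 1 * cIm z); first exact: (cReM (Complex 0 1) z).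
  by rewrite mul0r sub0r mulN1r mul1r.
have -> : cIm \o (fun x => Complex 0 1 * L1conv hC (phistar phi) x) =
    rconv h (rstar (cRe \o phi)).
  rewrite -r1; apply/funext => x; pose z := L1conv hC (phistar phi) x.
  transitivity (0 * cIm z + 1 * cRe z); first exact: (cImM (Complex 0 1) z).
  by rewrite mul0r add0r mul1r.
rewrite Z1; last exact: rL1_rconv (rL1_oc _ _) l2.
by rewrite mulN1r addrC.
Qed.

Lemma glide_not_Ksum (H1 H2 : R -> R) (B x0 : R) : continuous H1 -> continuous H2 ->
  (forall x, `|H1 x| <= B) -> (forall x, `|H2 x| <= B) ->
  H1 x0 != 0 \/ H2 x0 != 0 ->
  ~ Ksum (fun t => Complex (glide H1 t) (glide H2 t)) 0.
Proof.
move=> c1 c2 B1 B2 H0 [_ hK].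
have half H r : \int[mu]_(t in Rplus) (H t * oc 0 r t) = \int[mu]_t (H t * oc 0 r t).
  rewrite [LHS]Rintegral_mkcond; apply: eq_Rintegral => t _.
  rewrite patch_RplusE; case: ifPn => // t0.
  have [[_ /andP[h _]]|[-> _]] := oc_cases 0 r t; last by rewrite mulr0.
  by move: t0; rewrite ltW.
have test r : cintegrable Rplus (fun t => Complex (oc 0 r t) 0 : C).
  split; last exact: integrable0.
  exact: (@integrableS _ (measurableTypeR R) R mu setT Rplus (EFin \o oc 0 r)
    measurableT Rplus_measurable (@subsetT _ _) (rL1_oc 0 r)).
case: H0 => H0.
  have [r r0] := glide_ncvg0 c1 B1 H0; apply.
  have [+ _] := hK _ (test r); rewrite mul0r; apply: cvg_trans; apply: near_eq_cvg.
  near=> s; rewrite /= -half; apply: eq_Rintegral => t _.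
  by rewrite cReM /= mulr0 subr0.
have [r r0] := glide_ncvg0 c2 B2 H0; apply.
have [_ +] := hK _ (test r); rewrite mul0r; apply: cvg_trans; apply: near_eq_cvg.
near=> s; rewrite /= -half; apply: eq_Rintegral => t _.
by rewrite cImM /= mulr0 add0r.
Unshelve. all: by end_near. Qed.

Lemma glide_Sstar (H1 H2 : R -> R) (B : R) : continuous H1 -> continuous H2 ->
  (forall x, `|H1 x| <= B) -> (forall x, `|H2 x| <= B) ->
  (forall x, \int[mu]_t (H1 (t + x) * p1 t - H2 (t + x) * p2 t) = 0) ->
  (forall x, \int[mu]_t (H1 (t + x) * p2 t + H2 (t + x) * p1 t) = 0) ->
  Sstar phi (fun t => Complex (glide H1 t) (glide H2 t)) 0.
Proof.
move=> c1 c2 B1 B2 o1 o2.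
have m1 := continuous_measurable_fun c1; have m2 := continuous_measurable_fun c2.
pose J t := Complex (glide H1 t) (glide H2 t).
have mJ : cmeasurable Rplus J.
  by split; apply: measurable_funTS; exact: measurable_glide.
have lJ : Linfty_Rplus J.
  split => //; exists (B + B); apply: aeW => x _.
  apply: le_trans (cabs_le _) _.
  by apply: lerD; exact: norm_glide.
split => //.
have cv1 := glide_cvg0 m1 m2 B1 B2 lp1 lp2 p_neg o1.
(* The imaginary part is the same statement for the pair [(p2, - p1)]. *)
have p_neg' t : t < 0 -> p2 t = 0 /\ - p1 t = 0.
  by move=> /p_neg[-> ->]; rewrite oppr0.
have o2' x : \int[mu]_t (H1 (t + x) * p2 t - H2 (t + x) * - p1 t) = 0.
  by rewrite -(o2 x); apply: eq_Rintegral => t _; rewrite mulrN opprK.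
have cv2 := glide_cvg0 m1 m2 B1 B2 lp2 (rL1N lp1) p_neg' o2'.
apply: (@ccvg_near _ (fun x => Complex
  (\int[mu]_t (glide H1 (t + x) * p1 t - glide H2 (t + x) * p2 t))
  (\int[mu]_t (glide H1 (t + x) * p2 t - glide H2 (t + x) * - p1 t)))); last by split.
move=> x x0; rewrite (cint_tail_shift x0 mJ (cintegrable_measurable lphi)).
congr Complex; rewrite [RHS]Rintegral_mkcond; apply: eq_Rintegral => t _.
  rewrite patch_RplusE /p1 /p2 !patch_RplusE; case: ifP => _ /=.
    by rewrite cReM.
  by rewrite !mulr0 subr0.
rewrite patch_RplusE /p1 /p2 !patch_RplusE; case: ifP => _ /=.
  by rewrite cImM /= mulrN opprK.
by rewrite oppr0 !mulr0 subr0.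
Qed.

Let patch_opp (u : R -> R) t : t <> 0 -> (u \_ Rplus) (- t) = rstar u t.
Proof.
move=> t0; rewrite patch_RplusE /rstar oppr_ge0 le_eqVlt.
by have -> : (t == 0) = false by exact/eqP.
Qed.

(** Reflection carries integrals against [rstar u] to the half-line; the integrands may differ at 0
    alone. *)
Let Rintegral_window_opp (F u : R -> R) x : measurable_fun setT F ->
  mu.-integrable Rplus (EFin \o u) ->
  \int[mu]_t (F (- (t + x)) * (u \_ Rplus) t) = \int[mu]_t (F (- x + t) * rstar u t).
Proof.
move=> mF lu; have ms := rL1_measurable (rL1_rstar lu).
have mp := rL1_measurable (rL1_patch_Rplus lu).
have mFx : measurable_fun setT (fun t => F (- x + t)).
  under eq_fun do rewrite addrC.
  exact: (measurableT_comp mF (measurable_shift (- x))).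
have mo : measurable_fun setT (fun t : R => (u \_ Rplus) (- t)).
  exact: (measurableT_comp mp).
transitivity (\int[mu]_t (F (- x + t) * (u \_ Rplus) (- t))).
  rewrite -(@Rintegral_opp _ (fun t => F (- x + t) * (u \_ Rplus) (- t))); last first.
    exact: measurable_funM.
  by apply: eq_Rintegral => t _; rewrite opprK opprD addrC.
apply: ae_eq_Rintegral => //; [exact: measurable_funM..|].
exists [set 0]; split => //; first exact: lebesgue_measure_set1.
move=> t /= h; apply: contrapT => t0; apply: h => _; congr (_ * _).
exact: patch_opp.
Qed.

Lemma not_equivalent (I : set (R -> C)) g0 : closed_ideal I -> I (phistar phi) ->
  L1 g0 -> ~ I g0 ->
  exists J : R -> C, Sstar phi J 0 /\ ~ Ksum J 0.
Proof.
move=> cI Iphi lg0 Ig0.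
have [Lre [Lim [[D1 D2] [Z1 Z2] [N1 N2] LI Lg0]]] := closed_ideal_separation cI lg0 Ig0.
(* Otherwise both functionals vanish on every interval, hence on L1, against their value at [g0]. *)
have [d [x0 [d0 nz]]] : exists d x0 : R, 0 <= d /\
    (window Lre d x0 != 0 \/ window Lim d x0 != 0).
  apply: contrapT => h; move/eqP: Lg0; apply.
  have ocE a b : oc a b = oc a (a + (b - a)) by rewrite addrC subrK.
  rewrite (functional_step_eq0 D1 Z1 N1); [|move=> a b ab|exact: lg0.1].
    rewrite (functional_step_eq0 D2 Z2 N2) ?addr0//; [|exact: lg0.2].
    move=> a b ab; apply: contrapT => /eqP n; apply: h; exists (b - a), a.
    by split; [rewrite subr_ge0|right; rewrite /window -ocE].
  apply: contrapT => /eqP n; apply: h; exists (b - a), a.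
  by split; [rewrite subr_ge0|left; rewrite /window -ocE].
pose F1 := window Lre d; pose F2 := window Lim d.
have cF1 : continuous F1 := window_continuous D1 Z1 N1 d0.
have cF2 : continuous F2 := window_continuous D2 Z2 N2 d0.
have mF1 := continuous_measurable_fun cF1.
have mF2 := continuous_measurable_fun cF2.
have BF1 x : `|F1 x| <= d by exact: norm_window.
have BF2 x : `|F2 x| <= d by exact: norm_window.
(* The real functional [Lre f + Lim g] is the real part of a pairing of [f + i g] with a density
   whose windows are [F1 - i F2]; hence the sign in [H2]. *)
pose H1 x := F1 (- x); pose H2 x := - F2 (- x).
have cH1 : continuous H1.
  by move=> x; apply: continuous_comp; [exact: opp_continuous|exact: cF1].
have cH2 : continuous H2.
  move=> x; apply: (@continuous_comp _ _ _ (fun x => F2 (- x)) -%R).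
    by apply: continuous_comp; [exact: opp_continuous|exact: cF2].
  exact: opp_continuous.
have B1 x : `|H1 x| <= d by exact: BF1.
have B2 x : `|H2 x| <= d by rewrite normrN; exact: BF2.
have orth := ideal_window_orthogonal cI Iphi LI D1 D2 Z1 Z2 N1 N2 d0.
have lF (F p : R -> R) x : measurable_fun setT F -> (forall y, `|F y| <= d) ->
    rL1 p -> rL1 (fun t => F (- (t + x)) * p t).
  move=> mF BF lp; apply: (rL1Ml (M := d) _ _ lp) => //.
  apply: (measurableT_comp mF); exact: (measurableT_comp _ (measurable_shift x)).
exists (fun t => Complex (glide H1 t) (glide H2 t)); split.
  apply: (glide_Sstar cH1 cH2 B1 B2) => x; have [q1 q2] := orth (- x).
    rewrite /H1 /H2; under eq_Rintegral do rewrite mulNr opprK.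
    rewrite RintegralD//; [|exact: lF..].
    rewrite !Rintegral_window_opp//; [exact: lphi.2|exact: lphi.1].
  rewrite /H1 /H2; under eq_Rintegral do rewrite mulNr.
  rewrite RintegralB//; [|exact: lF..].
  rewrite !Rintegral_window_opp//; [|exact: lphi.1|exact: lphi.2].
  by apply/eqP; rewrite -oppr_eq0 opprB; apply/eqP.
apply: (@glide_not_Ksum H1 H2 d (- x0)) => //.
by rewrite /H1 /H2 opprK oppr_eq0.
Qed.

End necessity.

Theorem theorem4p2 (R : realType) (phi : R -> R[i]) :
  cintegrable Rplus phi -> cint Rplus phi = 1 ->
  (equivalent (Sstar phi) Ksum <-> closed_ideal_gen (phistar phi) = L1).
Proof.
move=> lphi phi1; split.
  move=> [_ [dom val]]; apply/seteqP; split.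
    (* For [w = 0] and [a = 0] Wiener's ideal is all of L1, which is thus one of the closed ideals
       in the intersection. *)
    pose w : R -> R[i] := fun=> 0.
    have m1 : measurable_fun setT (cRe \o w) by exact: (@measurable_cst _ _ R R).
    have m2 : measurable_fun setT (cIm \o w) by exact: (@measurable_cst _ _ R R).
    have b1 x : `|(cRe \o w) x| <= (0 : R) by rewrite normr0.
    have b2 x : `|(cIm \o w) x| <= (0 : R) by rewrite normr0.
    move=> g /(_ _ (conj (closed_ideal_tauberian 0 m1 m2 b1 b2) _))[] //.
    split; first exact: L1_phistar.
    rewrite mul0r (_ : L1conv _ _ = fun=> 0); first by split; exact: cvg_cst.
    apply/funext => x; have Z : rconv _ (fun=> 0 : R) x = 0.
      move=> h; rewrite /rconv -[RHS](_ : Rintegral (@lebesgue_measure R) setT (cst 0) = 0).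
        by apply: eq_Rintegral => t _; rewrite mulr0.
      by rewrite Rintegral_cst// mul0r.
    by rewrite /L1conv !Z subr0 addr0.
  move=> g lg I [cI Iphi]; apply: contrapT => Ig.
  have [J [SJ nKJ]] := not_equivalent lphi cI Iphi lg Ig.
  (* Only the value 0 has been excluded for [J]; agreement of the methods excludes any other [b]. *)
  have [b KJ] : domain Ksum J by apply: dom; exists 0.
  by apply: nKJ; rewrite -(val _ _ _ SJ KJ).
move=> gen; have SK f a : Sstar phi f a -> Ksum f a.
  by apply: Sstar_Ksum => //; rewrite gen.
have KS f a := @Ksum_Sstar R phi f a lphi phi1.
(* Values of [Ksum] are compared through [KS], by uniqueness of the limit defining [Sstar]. *)
split; split.
- by move=> f [a /KS]; exists a.
- by move=> f a b /KS Sa Sb; exact: Sstar_unique Sb Sa.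
- by move=> f [a /SK]; exists a.
by move=> f a b Sa /KS Sb; exact: Sstar_unique Sb Sa.
Qed.
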